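(* Let $\mathcal{X}$ be an infinite subset of $\mathbb{N}$, let $r\ge1$, and let $\gamma=(\phi_1,\dots,\phi_r)$ be a separated system of $r$ polynomials with integer coefficients and total degree $D_\gamma=\deg\phi_1+\cdots+\deg\phi_r$. Put $p=2-\frac{1}{r+1}$ and $q=p'$, where $\frac1p+\frac1{p'}=1$. Then for every $\epsilon>0$ there exists a positive constant $C_{\gamma,\epsilon}$, depending only on $\gamma$ and $\epsilon$, such that for all sufficiently large $N\in\mathbb{N}$, $$\|\mathcal{A}^{\gamma}_{\mathcal{X}\cap[N]}\|_{\ell^{p}(\mathbb{Z}^r)\to\ell^{q}(\mathbb{Z}^r)}\le C_{\gamma,\epsilon}\,N^{\epsilon}\Big(|\mathcal{X}\cap[N]|^{-D_\gamma(\frac1p-\frac1q)}+|\mathcal{X}\cap[N]|^{\frac1q-1}+|\mathcal{X}\cap[N]|^{-\frac1p}\Big).$$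
   Context: $\mathbb{N}=\{1,2,3,\dots\}$ and $[N]=\{1,\dots,N\}$; $|\cdot|$ of a finite set is its cardinality. A separated system of $r$ polynomials is a tuple $\gamma(T)=(\phi_1(T),\dots,\phi_r(T))$ of polynomials in $\mathbb{Z}[T]$ with $1\le\deg\phi_1<\deg\phi_2<\cdots<\deg\phi_r$. For a finite nonempty set $\mathcal{Y}\subset\mathbb{N}$ and $f:\mathbb{Z}^r\to\mathbb{C}$, define $$\mathcal{A}^{\gamma}_{\mathcal{Y}}f(\boldsymbol{x})=|\mathcal{Y}|^{-1}\sum_{n\in\mathcal{Y}}f(x_1+\phi_1(n),\dots,x_r+\phi_r(n)),\qquad\boldsymbol{x}\in\mathbb{Z}^r.$$ *)

(* Defs.v *)
From mathcomp Require Import all_boot all_order all_algebra.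
From mathcomp Require Import finmap complex.
From mathcomp Require Import boolp classical_sets functions cardinality reals.
From mathcomp Require Import ereal topology normedtype sequences esum exp.

Set Implicit Arguments.
Unset Strict Implicit.
Unset Printing Implicit Defensive.

Import Order.TTheory GRing.Theory Num.Theory.
Import numFieldNormedType.Exports.

Local Open Scope classical_set_scope.
Local Open Scope ring_scope.

Definition degree (P : {poly int}) : nat := (size P).-1.

Definition separated_system (r : nat) (gamma : 'I_r -> {poly int}) : Prop :=
  (forall i, (1 <= degree (gamma i))%N) /\
  (forall i j : 'I_r, (i < j)%N -> (degree (gamma i) < degree (gamma j))%N).

Definition total_degree (r : nat) (gamma : 'I_r -> {poly int}) : nat :=
  (\sum_(i < r) degree (gamma i))%N.

Definition truncation (X : set nat) (N : nat) : {fset nat} :=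
  [fset n in iota 1 N | n \in X]%fset.

(* Points of Z^r are integer row vectors. *)
Definition average (R : realType) (r : nat) (gamma : 'I_r -> {poly int})
    (Y : {fset nat}) (f : 'rV[int]_r -> R[i]) : 'rV[int]_r -> R[i] :=
  fun x => (#|` Y|%:R)^-1 *
    \sum_(n <- Y) f (x + \row_(i < r) (gamma i).[n%:Z]).

(* normc is the real-valued modulus; for 0 < p, the norm is +oo off l^p. *)
Definition lnorm (R : realType) (T : choiceType) (p : R) (f : T -> R[i]) :
    \bar R :=
  ((\esum_(x in [set: T]) (ComplexField.Normc.normc (f x) `^ p)%:E)
     `^ p^-1)%E.

Definition opnorm (R : realType) (T : choiceType) (p q : R)
    (A : (T -> R[i]) -> (T -> R[i])) : \bar R :=
  ereal_sup [set lnorm q (A f) | f in [set f | (lnorm p f <= 1)%E]].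

(* Main.v *)
Require Import Defs.
From mathcomp Require Import all_boot all_order all_algebra.
From mathcomp Require Import finmap complex.
From mathcomp Require Import boolp classical_sets functions cardinality reals.
From mathcomp Require Import ereal topology normedtype sequences esum exp.
From mathcomp Require Import fsbigop zify ring lra.

Set Implicit Arguments.
Unset Strict Implicit.
Unset Printing Implicit Defensive.

Import Order.TTheory GRing.Theory Num.Theory.
Import numFieldNormedType.Exports.

Local Open Scope classical_set_scope.
Local Open Scope ring_scope.

(** Write [M = |Y|] and let [I] count the incidences [x + gamma n \in E] with
    [x \in F], [n \in Y].  Everything rests on
    [I ^ (2r+1) <= C N^eps M^r (|E| |F|) ^ (r+1)], which a dyadic decomposition
    turns into the norm inequality with the factor [M ^ (- 1/p)].

    For the incidence bound, pass to a subgraph of large minimal degree and count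
    walks of length [L >= r+1].  The displacement of a walk is an alternating sum
    [h = gamma n_1 - gamma n_2 + ...].  A dimension count gives an integer
    polynomial [G <> 0] vanishing on the alternating sums of length [L - 2] but
    not on those of length [L].  Each [n_i - n_(i+1)] divides [G h], so if
    [G h <> 0] the divisor bound leaves [O(N^eps)] possible sequences of
    differences; then [n_1] is a root of a nonconstant polynomial, because some
    component of [gamma] has degree at least 2.  Walks with [G h = 0] or
    [n_1 - n_2 + ... = 0] are avoided by excluding boundedly many values at each
    step.  If no component has degree 2
    or more, then [r = 1], [gamma] is linear and the trivial bounds
    [I <= M |E|, M |F|, |E| |F|] give the first term. *)

(** * Alternating sums and walks in sum graphs *)

Fixpoint alt (A : Type) (V : zmodType) (g : A -> V) (s : seq A) : V :=
  if s is a :: s' then g a - alt g s' else 0.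

Lemma alt_cat (A : Type) (V : zmodType) (g : A -> V) (s t : seq A) :
  alt g (s ++ t) = alt g s + (if odd (size s) then - alt g t else alt g t).
Proof.
elim: s => [|a s IH] /=; first by rewrite add0r.
by rewrite IH; case: (odd _); rewrite /= opprD ?opprK addrA.
Qed.

Lemma alt_map (A : Type) (V W : zmodType) (f : {additive V -> W})
    (g : A -> V) (s : seq A) : f (alt g s) = alt (fun a => f (g a)) s.
Proof. by elim: s => [|a s IH] /=; rewrite ?raddf0 // raddfB IH. Qed.

Lemma alt_comp (A B : Type) (V : zmodType) (g : B -> V) (h : A -> B)
    (s : seq A) : alt g (map h s) = alt (fun a => g (h a)) s.
Proof. by elim: s => [|a s IH] //=; rewrite IH. Qed.

Lemma eq_alt (A : Type) (V : zmodType) (g h : A -> V) :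
  g =1 h -> alt g =1 alt h.
Proof. by move=> gh; elim=> [|a s IH] //=; rewrite gh IH. Qed.

Section NatPart.
Local Open Scope nat_scope.

Lemma size_fibres (T U : eqType) (f : T -> U) (s : seq T) (u : seq U) c :
    (forall x, x \in s -> f x \in u) ->
    (forall y, y \in u -> count (fun x => f x == y) s <= c) ->
  size s <= size u * c.
Proof.
move=> fu fib.
have -> : size s = \sum_(y <- undup u) count (fun x => f x == y) s.
  elim: s fu {fib} => [|x s IH] fu /=; first by rewrite big1.
  rewrite big_split /= -IH; last by move=> z zs; apply: fu; rewrite inE zs orbT.
  rewrite (bigD1_seq (f x)) ?undup_uniq ?mem_undup ?fu ?mem_head //=.
  by rewrite eqxx big1 // => y /negPf; rewrite eq_sym => ->.
apply: (@leq_trans (\sum_(y <- undup u) c)).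
  by rewrite big_seq [leqRHS]big_seq; apply: leq_sum => y; rewrite mem_undup; apply: fib.
by rewrite big_const_seq count_predT iter_addn_0 mulnC leq_mul2r size_undup orbT.
Qed.

Lemma leq_expl m n e : m <= n -> m ^ e <= n ^ e.
Proof. by case: e => // e; rewrite leq_exp2r. Qed.

Fixpoint tuples (T : Type) (Y : seq T) (L : nat) : seq (seq T) :=
  if L is L'.+1 then [seq n :: s | n <- Y, s <- tuples Y L'] else [:: [::]].

Lemma mem_tuples (T : eqType) (Y : seq T) L s :
  (s \in tuples Y L) = (size s == L) && all (mem Y) s.
Proof.
elim: L s => [|L IH] [|n s] //=.
  by apply/negbTE/negP => /allpairsP[[m t] []].
apply/allpairsP/andP => [[[m t] /= [mY tT [-> ->]]]|[sL /andP[nY sY]]].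
  by move: tT; rewrite IH => /andP[/eqP -> ->]; rewrite mY.
by exists (n, s); rewrite IH eqSS in sL *; rewrite sL sY.
Qed.

Lemma size_tuples (T : Type) (Y : seq T) L : size (tuples Y L) = size Y ^ L.
Proof. by elim: L => //= L IH; rewrite size_allpairs IH expnS. Qed.

Lemma uniq_tuples (T : eqType) (Y : seq T) L : uniq Y -> uniq (tuples Y L).
Proof.
move=> uY; elim: L => //= L IH.
by apply: allpairs_uniq => // -[a b] [c d] _ _ [-> ->].
Qed.

(** A sequence built entry by entry satisfies [Q] as soon as each entry avoids at most [K] values,
    which may depend on the earlier entries. This survives restricting each entry to the edges
    available at the current vertex of a walk. *)
Fixpoint avoid (K L : nat) (Q : pred (seq nat)) : Prop :=
  if L is L'.+1 then
    exists2 bad : pred nat,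
      forall l, uniq l -> all bad l -> size l <= K &
      forall n, ~~ bad n -> avoid K L' (fun s => Q (n :: s))
  else Q [::].

Lemma avoidI K1 K2 L Q1 Q2 : avoid K1 L Q1 -> avoid K2 L Q2 ->
  avoid (K1 + K2) L (fun s => Q1 s && Q2 s).
Proof.
elim: L Q1 Q2 => [|L IH] Q1 Q2 /=; first by move=> -> ->.
move=> [b1 s1 h1] [b2 s2 h2]; exists (fun n => b1 n || b2 n) => [l ul bl|n].
  rewrite -(count_predC b1 l) -!size_filter leq_add //.
    by apply: s1; rewrite ?filter_uniq ?filter_all.
  apply: s2; first by rewrite filter_uniq.
  apply/allP => n; rewrite mem_filter /= => /andP[nb1 nl].
  by move/allP: bl => /(_ n nl); rewrite (negPf nb1).
by rewrite negb_or => /andP[n1 n2]; apply: IH; [apply: h1 | apply: h2].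
Qed.

(** Lower bound for the number of walks of length [L] in a bipartite graph whose sides have minimal
    degrees [u] (the starting side) and [v]. *)
Fixpoint alternating_prod (L u v : nat) : nat :=
  if L is L'.+1 then u * alternating_prod L' v u else 1.

Lemma alternating_prodM L u v :
  alternating_prod L u v * alternating_prod L v u = (u * v) ^ L.
Proof.
elim: L u v => [|L IH] u v //=.
by rewrite mulnACA IH [v * u]mulnC -expnS.
Qed.

End NatPart.

(** * Minimal degree, walks and the incidence bound *)

Section SumGraph.
Local Open Scope nat_scope.
Variables (V : zmodType) (g : nat -> V) (Y : seq nat).

(* Incidences [x + g n \in E] with [x \in F] are encoded by [A = F], [B = - E] and
   the relation [x + z + g n = 0], which is symmetric in [x] and [z]. *)
Definition sum_degree (B : seq V) (x : V) : nat :=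
  count (fun n => (- (x + g n))%R \in B) Y.

Definition sum_edges (A B : seq V) : nat := \sum_(x <- A) sum_degree B x.

(** Both sides count the triples [x], [z], [n] with [x + z + g n = 0]. *)
Lemma sum_edgesC A B : uniq A -> uniq B -> sum_edges A B = sum_edges B A.
Proof.
have deg C x : uniq C -> sum_degree C x =
    \sum_(z <- C) \sum_(n <- Y) ((x + z + g n)%R == 0%R).
  move=> uC; rewrite exchange_big /= /sum_degree -sum1_count big_mkcond /=.
  apply: eq_bigr => n _.
  have E z : ((x + z + g n)%R == 0%R) = (z == (- (x + g n))%R).
    by rewrite addrAC addrC addr_eq0.
  under eq_bigr do rewrite E.
  case: ifPn => [xC|xC].
    by rewrite (bigD1_seq _ xC uC) /= eqxx big1 // => z /negPf ->.
  rewrite big_seq big1 // => z zC.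
  by case: eqP => // zE; rewrite -zE zC in xC.
move=> uA uB; rewrite /sum_edges.
under eq_bigr do rewrite deg //.
under [RHS]eq_bigr do rewrite deg //.
rewrite exchange_big /=; apply: eq_bigr => z _; apply: eq_bigr => x _.
by apply: eq_bigr => n _; rewrite [(x + z)%R]addrC.
Qed.

Lemma sum_edges_rem A B x : x \in A ->
  sum_edges A B = sum_degree B x + sum_edges (rem x A) B.
Proof. by move=> xA; rewrite /sum_edges (perm_big _ (perm_to_rem xA)) big_cons. Qed.

(** Delete vertices of degree at most [a] in [A] or at most [b] in [B] one at a time. A deletion
    lowers the left side of the inequality at least as much as the number of edges, so the strict
    inequality persists and neither side can become empty. *)
Lemma sum_graph_core A B a b : uniq A -> uniq B ->
    a * size A + b * size B < sum_edges A B ->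
  exists A' B' : seq V, [/\ uniq A', uniq B', {subset A' <= A}, {subset B' <= B} &
    [/\ A' != [::], B' != [::],
      forall x, x \in A' -> a < sum_degree B' x &
      forall z, z \in B' -> b < sum_degree A' z]].
Proof.
have [k] := ubnP (size A + size B).
elim: k A B => // k IH A B szk uA uB lt.
have [/hasP[x xA xa]|/hasPn hA] := boolP (has (fun x => sum_degree B x <= a) A).
  have szA : (size (rem x A)).+1 = size A by rewrite size_rem // prednK //; case: (A) xA.
  case: (IH (rem x A) B); rewrite ?rem_uniq //.
  - by move: szk; rewrite -szA.
  - by move: lt; rewrite (sum_edges_rem _ xA) -szA mulnS; lia.
  move=> A' [B' [u1 u2 s1 s2 H]]; exists A', B'; split=> //.
  by move=> y /s1 /mem_rem.
have [/hasP[z zB zb]|/hasPn hB] := boolP (has (fun z => sum_degree A z <= b) B).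
  have szB : (size (rem z B)).+1 = size B by rewrite size_rem // prednK //; case: (B) zB.
  case: (IH A (rem z B)); rewrite ?rem_uniq //.
  - by move: szk; rewrite -szB addnS.
  - move: lt; rewrite !(sum_edgesC uA) ?rem_uniq //.
    by rewrite (sum_edges_rem _ zB) -szB mulnS; lia.
  move=> A' [B' [u1 u2 s1 s2 H]]; exists A', B'; split=> //.
  by move=> y /s2 /mem_rem.
exists A, B; split=> //; split=> //.
- by apply/eqP => A0; move: lt; rewrite A0 /sum_edges big_nil.
- by apply/eqP => B0; move: lt; rewrite sum_edgesC // B0 /sum_edges big_nil.
- by move=> x /hA; rewrite -ltnNge.
- by move=> z /hB; rewrite -ltnNge.
Qed.

Fixpoint walk (A B : seq V) (x : V) (s : seq nat) : bool :=
  if s is n :: s' then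
    let y := (- (x + g n))%R in (y \in B) && walk B A y s'
  else true.

(** Every step negates, so the contributions of successive steps enter with alternating signs. For a
    fixed start, the endpoint therefore determines the alternating sum. *)
Lemma walk_end A B x s : x \in A -> walk A B x s ->
  (if odd (size s) then (- (x + alt g s))%R \in B else (x + alt g s)%R \in A).
Proof.
elim: s A B x => [|n s IH] A B x xA /=; first by rewrite addr0.
move=> /andP[yB /(IH _ _ _ yB)].
have -> : (- (x + g n) + alt g s = - (x + (g n - alt g s)))%R.
  by rewrite addrA opprB [(_ + (- _))%R]addrC.
by case: (odd (size s)) => //=; rewrite opprK.
Qed.

(** At a vertex of [A] at least [a] steps stay in the graph and at most [K] of them are forbidden;
    the two sides then exchange roles. *)
Lemma walk_count K a b L A B Q x : uniq Y ->
    (forall x, x \in A -> a <= sum_degree B x) ->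
    (forall z, z \in B -> b <= sum_degree A z) ->
    x \in A -> avoid K L Q ->
  alternating_prod L (a - K) (b - K) <=
    count (fun s => walk A B x s && Q s) (tuples Y L).
Proof.
move=> uY; elim: L a b A B Q x => [|L IH] a b A B Q x hA hB xA /=; first by move=> ->.
move=> [bad sbad hbad].
rewrite count_flatten -map_comp sumnE big_map /=.
under eq_bigr do rewrite count_map /=.
pose P n := ((- (x + g n))%R \in B) && ~~ bad n.
apply: (@leq_trans (\sum_(n <- Y | P n) alternating_prod L (b - K) (a - K))).
  rewrite big_const_seq iter_addn_0 mulnC leq_mul2l; apply/orP; right.
  rewrite leq_subLR; apply: leq_trans (hA _ xA) _.
  rewrite /sum_degree -size_filter.
  set F := [seq _ <- Y | _]; rewrite -(count_predC bad F) leq_add //.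
    rewrite -size_filter; apply: sbad; first by rewrite !filter_uniq.
    exact: filter_all.
  rewrite count_filter; apply: sub_count => n /=.
  by rewrite /P /= andbC.
rewrite big_mkcond /=; apply: leq_sum => n _; rewrite /P.
case: ifP => // /andP[yB /hbad av].
apply: leq_trans (IH b a B A _ _ hB hA yB av) _.
by apply: sub_count => s /=; rewrite yB.
Qed.

(* With [u = a - K] and [v = b - K], walks of length [L] from a vertex of the
   refined [A'] (resp. [B']) produce [u v u ...] (resp. [v u v ...]) admissible
   tuples, which share an endpoint at most [c] at a time; multiplying the two
   resulting inequalities gives [(u v) ^ L <= |A| |B| c ^ 2]. *)
Lemma sum_edges_le (r K L c : nat) (Q : pred (seq nat)) (A B : seq V) :
    uniq Y -> uniq A -> uniq B -> 0 < K -> 0 < c -> r < L -> avoid K L Q ->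
    (forall h : V, count (fun s => Q s && (alt g s == h)) (tuples Y L) <= c) ->
  sum_edges A B ^ (2 * (2 * r + 1)) <=
    (16 * K) ^ (2 * r.+1) * c ^ 2 * size Y ^ (2 * r) * (size A * size B) ^ (2 * r.+1).
Proof.
move=> uY uA uB K0 c0 rL avQ fibQ.
set I := sum_edges A B; set M := size Y; set a := size A; set b := size B.
have edges_le C D : sum_edges C D <= M * size C.
  apply: (@leq_trans (\sum_(x <- C) M)).
    by apply: leq_sum => x _; apply: count_size.
  by rewrite big_const_seq count_predT iter_addn_0.
have IA : I <= M * a by apply: edges_le.
have IB : I <= M * b by rewrite /I sum_edgesC //; apply: edges_le.
have [->|I0] := posnP I; first by rewrite exp0n // muln_gt0 addn1.
have a0 : 0 < a by move: (leq_trans I0 IA); rewrite muln_gt0 => /andP[].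
have b0 : 0 < b by move: (leq_trans I0 IB); rewrite muln_gt0 => /andP[].
(* When the average degree on one side is [O(K)], the trivial bound from the other side suffices. *)
have small x y : I <= 4 * K * x -> I <= M * y -> x * y = a * b ->
    I ^ (2 * (2 * r + 1)) <= (16 * K) ^ (2 * r.+1) * c ^ 2 * M ^ (2 * r) * (a * b) ^ (2 * r.+1).
  move=> Ix Iy xy.
  have -> : 2 * (2 * r + 1) = 2 * r.+1 + 2 * r by rewrite mulnDr mulnS; ring.
  rewrite expnD; apply: (@leq_trans ((4 * K * x) ^ (2 * r.+1) * (M * y) ^ (2 * r))).
    by rewrite leq_mul // leq_expl.
  have y0 : 0 < y by move: (leq_trans I0 Iy); rewrite muln_gt0 => /andP[].
  have -> : (16 * K) ^ (2 * r.+1) * c ^ 2 * M ^ (2 * r) * (a * b) ^ (2 * r.+1) =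
      (16 * K * x) ^ (2 * r.+1) * M ^ (2 * r) * (y ^ (2 * r.+1) * c ^ 2).
    by rewrite -xy !expnMn; ring.
  rewrite [(M * y) ^ _]expnMn mulnA; apply: leq_mul.
    by rewrite leq_mul2r leq_expl ?orbT // !leq_mul2r !orbT.
  have -> : 2 * r.+1 = 2 * r + 2 by rewrite mulnS addnC.
  by rewrite expnD -mulnA leq_pmulr // muln_gt0 !expn_gt0 y0 c0.
(* About half the average degrees. Dividing [I - 1] instead of [I] gives [a * a1 + b * b1 < I], the
   strict inequality that [sum_graph_core] asks for. *)
pose a1 := (I - 1) %/ (2 * a); pose b1 := (I - 1) %/ (2 * b).
have a1I : I <= 2 * a * a1.+1.
  have := ltn_ceil (I - 1) (_ : 0 < 2 * a); rewrite muln_gt0 a0 => /(_ isT).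
  by rewrite -/a1 mulnC; lia.
have b1I : I <= 2 * b * b1.+1.
  have := ltn_ceil (I - 1) (_ : 0 < 2 * b); rewrite muln_gt0 b0 => /(_ isT).
  by rewrite -/b1 mulnC; lia.
have [aK|Ka] := ltnP a1.+1 (2 * K).
  apply: (small a b) => //; apply: leq_trans a1I _.
  have -> : 4 * K * a = 2 * a * (2 * K) by ring.
  by rewrite leq_mul2l (ltnW aK) orbT.
have [bK|Kb] := ltnP b1.+1 (2 * K).
  apply: (small b a) => //; last by rewrite mulnC.
  apply: leq_trans b1I _.
  have -> : 4 * K * b = 2 * b * (2 * K) by ring.
  by rewrite leq_mul2l (ltnW bK) orbT.
(* Since [a1.+1] and [b1.+1] are at least [2 * K], discarding [K] choices costs at most a factor
   2. *)
pose u := a1.+1 - K; pose v := b1.+1 - K.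
have uI : I <= 4 * a * u.
  apply: leq_trans a1I _; have -> : 4 * a * u = 2 * a * (2 * u) by ring.
  by rewrite leq_mul2l /u; apply/orP; right; lia.
have vI : I <= 4 * b * v.
  apply: leq_trans b1I _; have -> : 4 * b * v = 2 * b * (2 * v) by ring.
  by rewrite leq_mul2l /v; apply/orP; right; lia.
have u0 : 0 < u by rewrite /u; lia.
have v0 : 0 < v by rewrite /v; lia.
have [|A' [B' [uA' uB' sA sB [A'0 B'0 dA dB]]]] :=
    @sum_graph_core A B a1 b1 uA uB.
  rewrite -/I -/a -/b.
  have := leq_divM (I - 1) (2 * a); have := leq_divM (I - 1) (2 * b).
  by rewrite -/a1 -/b1; lia.
have ends C D C' D' x w t : uniq C -> uniq D -> x \in C' -> {subset C' <= C} ->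
    {subset D' <= D} -> (forall y, y \in C' -> w.+1 <= sum_degree D' y) ->
    (forall y, y \in D' -> t.+1 <= sum_degree C' y) ->
    alternating_prod L (w.+1 - K) (t.+1 - K) <= (if odd L then size D else size C) * c.
  move=> uC uD xC sC sD dC dD.
  apply: leq_trans (walk_count uY dC dD xC avQ) _.
  rewrite -size_filter.
  pose f s : V := if odd L then (- (x + alt g s))%R else (x + alt g s)%R.
  have -> : (if odd L then size D else size C) = size (if odd L then D else C).
    by case: ifP.
  apply: (@size_fibres _ _ f) => [s|y _].
    rewrite mem_filter mem_tuples => /andP[/andP[ws _] /andP[/eqP sL _]].
    have := walk_end xC ws; rewrite sL /f; case: ifP => _; first exact: sD.
    exact: sC.
  rewrite count_filter.
  pose h := ((if odd L then - y else y) - x)%R.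
  apply: leq_trans (fibQ h); apply: sub_count => s /= /andP[/eqP fs /andP[_ ->]] /=.
  rewrite /h -fs /f; case: (odd L); first by rewrite opprK addrC addKr.
  by rewrite addrC addKr.
have /hasP[x xA _] : has predT A' by rewrite has_predT; case: (A') A'0.
have /hasP[z zB _] : has predT B' by rewrite has_predT; case: (B') B'0.
have := leq_mul (ends _ _ _ _ _ _ _ uA uB xA sA sB dA dB)
  (ends _ _ _ _ _ _ _ uB uA zB sB sA dB dA).
rewrite -/u -/v alternating_prodM -/a -/b.
have -> : (if odd L then b else a) * c * ((if odd L then a else b) * c) = a * b * c ^ 2.
  by case: ifP; rewrite mulnACA mulnn // [b * a]mulnC.
move=> uvL.
have uvr : (u * v) ^ r.+1 <= a * b * c ^ 2.
  by apply: leq_trans uvL; rewrite leq_pexp2l // muln_gt0 u0.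
have I2 : I ^ 2 <= 16 * (a * b) * (u * v).
  have -> : 16 * (a * b) * (u * v) = 4 * a * u * (4 * b * v) by ring.
  by rewrite -mulnn leq_mul.
have M2 : I ^ 2 <= M ^ 2 * (a * b).
  have -> : M ^ 2 * (a * b) = M * a * (M * b) by ring.
  by rewrite -mulnn leq_mul.
(* The degree bound [I2] is used [r.+1] times and the trivial bound [M2] is used [r] times. *)
have -> : 2 * (2 * r + 1) = 2 * r.+1 + 2 * r by rewrite mulnDr mulnS; ring.
rewrite expnD !expnM.
apply: (@leq_trans ((16 * (a * b) * (u * v)) ^ r.+1 * (M ^ 2 * (a * b)) ^ r)).
  by rewrite leq_mul // leq_expl.
have -> : (16 * (a * b) * (u * v)) ^ r.+1 * (M ^ 2 * (a * b)) ^ r =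
    16 ^ r.+1 * ((a * b) ^ r.+1 * (a * b) ^ r) * (M ^ 2) ^ r * (u * v) ^ r.+1.
  by rewrite !expnMn !expnS; ring.
apply: leq_trans (leq_mul (leqnn _) uvr) _.
have -> : 16 ^ r.+1 * ((a * b) ^ r.+1 * (a * b) ^ r) * (M ^ 2) ^ r * (a * b * c ^ 2) =
    16 ^ r.+1 * c ^ 2 * (M ^ 2) ^ r * ((a * b) ^ 2) ^ r.+1.
  by rewrite -!expnM !expnMn !mul2n -!addnn !expnD !expnS; ring.
rewrite !leq_mul2r; apply/orP; right; apply/orP; right; apply/orP; right.
rewrite leq_expl //; apply: leq_trans (leq_pmulr 16 K0) _.
by rewrite -mulnn leq_pmulr // muln_gt0.
Qed.

End SumGraph.

(** * The divisor bound *)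

Section Divisors.
Local Open Scope nat_scope.

Lemma expS_le_exp2 (k e : nat) : 0 < k -> e.+1 ^ k <= k ^ k * 2 ^ e.
Proof.
move=> k0.
have ek : e.+1 <= k * 2 ^ (e %/ k).
  apply: leq_trans (ltn_ceil e k0) _.
  by rewrite mulnC leq_mul2l ltn_expl ?orbT.
apply: leq_trans (leq_expl k ek) _.
by rewrite expnMn -expnM leq_mul2l leq_pexp2l ?leq_divM ?orbT.
Qed.

Lemma size_divisors_part (p m : nat) : 0 < m ->
  size (divisors m) <= (logn p m).+1 * size (divisors m`_p^').
Proof.
move=> m0.
rewrite -[(logn p m).+1](size_iota 0) -(size_allpairs (fun i d => p ^ i * d)).
apply: uniq_leq_size; first exact: divisors_uniq.
move=> d; rewrite -dvdn_divisors // => dm.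
have d0 : 0 < d by apply: dvdn_gt0 dm.
apply/allpairsP; exists (logn p d, d`_p^'); split.
- by rewrite mem_iota /= ltnS dvdn_leq_log.
- by rewrite -dvdn_divisors ?part_gt0 // partn_dvd.
- by rewrite -p_part partnC.
Qed.

(* Prime powers [p ^ e] with [p >= 2 ^ k] satisfy [(e + 1) ^ k <= p ^ e]; each
   of the boundedly many smaller primes costs a factor [k ^ k]. *)
Lemma size_divisors_exp_le (k m : nat) : 0 < k -> 0 < m ->
  size (divisors m) ^ k <= (k ^ k) ^ (2 ^ k) * m.
Proof.
move=> k0 m0.
(* The exponent must count exactly the small primes dividing [m]: the induction strips the full
   power of the least prime factor, and [cnt] drops when that prime is small. *)
pose cnt m := count (fun p => prime p && (p %| m)) (iota 0 (2 ^ k)).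
suff H : size (divisors m) ^ k <= (k ^ k) ^ cnt m * m.
  apply: leq_trans H _; rewrite leq_mul2r leq_pexp2l ?orbT ?expn_gt0 ?k0 //.
  by rewrite -[leqRHS](size_iota 0) count_size.
have [n] := ubnP m; elim: n m m0 => // n IH m m0 mn.
have [m1|m1] := leqP m 1.
  have -> : m = 1 by apply/eqP; rewrite eqn_leq m1.
  by rewrite exp1n muln1 expn_gt0 expn_gt0 k0.
set p := pdiv m; have pp : prime p by apply: pdiv_prime.
have pm : p %| m by apply: pdiv_dvd.
set e := logn p m; set m' := m`_p^'.
have me : m = p ^ e * m' by rewrite -p_part partnC.
have m'0 : 0 < m' by apply: part_gt0.
have e0 : 0 < e by rewrite logn_gt0 mem_primes pp m0 pm.
have m'n : m' < n.
  rewrite ltnS in mn; apply: leq_trans mn; rewrite me ltn_Pmull //.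
  by rewrite -(exp1n e) ltn_exp2r // prime_gt1.
have m'm : m' %| m by rewrite [m in _ %| m]me dvdn_mull.
have pm' : ~~ (p %| m').
  rewrite -prime_coprime // (@pnat_coprime p) ?pnat_id //.
  exact: part_pnat.
apply: leq_trans (leq_expl k (size_divisors_part p m0)) _.
rewrite -/e -/m' expnMn.
apply: leq_trans (leq_mul (leqnn _) (IH _ m'0 m'n)) _.
have cntm' : cnt m' + (p < 2 ^ k) <= cnt m.
  have -> : (p < 2 ^ k) = (p \in iota 0 (2 ^ k)) by rewrite mem_iota.
  rewrite -count_uniq_mem ?iota_uniq // -count_predUI.
  rewrite [X in _ + X](_ : _ = 0) ?addn0.
    apply: sub_count => l /= /orP[/andP[-> lm']|/eqP ->] /=.
      exact: dvdn_trans m'm.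
    by rewrite pp.
  apply/eqP; rewrite -leqn0 leqNgt -has_count; apply/hasPn => l _ /=.
  by case: eqP => [->|_]; rewrite ?andbF // (negPf pm') andbF.
rewrite {2}me mulnA [leqRHS]mulnA leq_mul2r; apply/orP; right.
have [pk|kp] := ltnP p (2 ^ k).
  rewrite pk addn1 in cntm'.
  apply: (@leq_trans ((k ^ k) ^ (cnt m').+1 * p ^ e)); last first.
    by rewrite leq_mul2r leq_pexp2l ?orbT // expn_gt0 k0.
  rewrite expnS mulnAC leq_mul2r; apply/orP; right.
  apply: leq_trans (expS_le_exp2 e k0) _.
  by rewrite leq_mul2l leq_expl ?orbT ?prime_gt1.
rewrite ltnNge kp addn0 in cntm'.
rewrite mulnC; apply: leq_mul; first by rewrite leq_pexp2l // expn_gt0 k0.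
apply: leq_trans (leq_expl e kp); rewrite -expnM mulnC expnM.
by rewrite leq_expl // ltn_expl.
Qed.

End Divisors.

(** * Separately polynomial functions *)

(** Degree at most [K] in each variable, expressed only through one-variable slices; both the grid
    argument and the avoidance argument proceed one variable at a time. *)
Fixpoint sep_poly (K m : nat) (P : seq nat -> int) : Prop :=
  if m is m'.+1 then
    (forall s, size s = m' ->
       exists2 p : {poly int}, (size p <= K.+1)%N & forall t : nat, P (t :: s) = p.[t%:Z]) /\
    (forall t, sep_poly K m' (fun s => P (t :: s)))
  else True.

Lemma eq_sep_poly K m P Q : P =1 Q -> sep_poly K m P -> sep_poly K m Q.
Proof.
elim: m P Q => //= m IH P Q PQ [Hp Ht]; split=> [s /Hp [p szp Pp]|t].
  by exists p => // t; rewrite -PQ.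
by apply: IH (Ht t) => s; apply: PQ.
Qed.

Lemma size_nat_roots (p : {poly int}) (l : seq nat) :
  p != 0 -> uniq l -> all (fun t : nat => p.[t%:Z] == 0) l -> (size l < size p)%N.
Proof.
move=> p0 ul al; rewrite -(size_map Posz) max_poly_roots //.
  by rewrite all_map.
by rewrite map_inj_uniq // => x y [].
Qed.

(** By induction, the slice in the first variable vanishes at [K + 1] points and so is zero. *)
Lemma sep_poly_grid0 K m P : sep_poly K m P ->
    (forall s, s \in tuples (iota 0 K.+1) m -> P s = 0) ->
  forall s, size s = m -> P s = 0.
Proof.
elim: m P => [|m IH] P.
  by move=> _ H [|//] _; apply: H; rewrite inE.
move=> [Hp Ht] H0 [//|t s] [sm].
have [p szp Pp] := Hp s sm.
have [pE|p0] := eqVneq p 0; first by rewrite Pp pE horner0.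
suff /(size_nat_roots p0 (iota_uniq 0 K.+1)) : all (fun t : nat => p.[t%:Z] == 0) (iota 0 K.+1).
  by rewrite size_iota ltnNge szp.
apply/allP => u uK; rewrite -Pp (IH _ (Ht u)) // => s' s'K.
by apply: H0; rewrite !mem_tuples /= in s'K *; rewrite eqSS uK.
Qed.

(** The bad values are the roots of the slice through [s0]; outside them, the tail of [s0] is still
    a witness for the remaining entries. *)
Lemma sep_poly_avoid K m P s0 : sep_poly K m P -> size s0 = m -> P s0 != 0 ->
  avoid K m (fun s => P s != 0).
Proof.
elim: m P s0 => [|m IH] P s0 /=; first by move=> _ /size0nil ->.
move=> [Hp Ht]; case: s0 => [//|t0 s0] [sm] P0.
have [p szp Pp] := Hp s0 sm.
exists (fun t : nat => p.[t%:Z] == 0) => [l ul al|t pt].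
  rewrite -ltnS; apply: leq_trans szp; apply: size_nat_roots al => //.
  by apply: contra_neq P0; rewrite Pp => ->; rewrite horner0.
by apply: (IH _ s0) => //; rewrite Pp.
Qed.

(** Both signs occur because the entries of an alternating sum are added and subtracted in turn. *)
Definition poly_along (V : zmodType) (g : nat -> V) (K : nat) (H : V -> int) : Prop :=
  forall b,
    (exists2 p : {poly int}, (size p <= K.+1)%N & forall t, H (b + g t) = p.[t%:Z]) /\
    (exists2 p : {poly int}, (size p <= K.+1)%N & forall t, H (b - g t) = p.[t%:Z]).

Lemma sep_poly_alt (V : zmodType) (g : nat -> V) K H m : poly_along g K H ->
  sep_poly K m (fun s => H (alt g s)).
Proof.
move=> gH.
suff S b : sep_poly K m (fun s => H (b + alt g s)) /\ sep_poly K m (fun s => H (b - alt g s)).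
  by have [+ _] := S 0; apply: eq_sep_poly => s; rewrite add0r.
elim: m b => //= m IH b; split; split.
- move=> s _; have [[p szp Hp] _] := gH (b - alt g s); exists p => // t.
  by rewrite -Hp /= addrA addrAC.
- move=> t; have [_] := IH (b + g t).
  by apply: eq_sep_poly => s /=; rewrite addrA.
- move=> s _; have [_ [p szp Hp]] := gH (b + alt g s); exists p => // t.
  by rewrite -Hp /= opprB addrA addrAC.
- move=> t; have [+ _] := IH (b - g t).
  by apply: eq_sep_poly => s /=; rewrite opprB addrA addrAC.
Qed.

Lemma alt_nonzero_avoid L : (0 < L)%N -> avoid 1 L (fun s => alt Posz s != 0).
Proof.
case: L => // L _; apply: (@sep_poly_avoid _ _ _ (1%N :: nseq L 0%N)).
- apply: (@sep_poly_alt _ Posz 1 id) => b; split.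
    exists ('X + b%:P); first by rewrite size_XaddC.
    by move=> t; rewrite !hornerE addrC.
  exists (b%:P - 'X); first by rewrite -opprB size_polyN size_XsubC.
  by move=> t; rewrite !hornerE.
- by rewrite /= size_nseq.
- rewrite /=; have -> : alt Posz (nseq L 0%N) = 0 :> int by elim: L => //= L ->.
  by [].
Qed.

(** * Functions behaving like integer polynomials in several variables *)

Definition congruence_preserving (r : nat) (F : 'rV[int]_r -> int) : Prop :=
  forall m (h h' : 'rV[int]_r), (forall j, (m %| h ord0 j - h' ord0 j)%Z) -> (m %| F h - F h')%Z.

Definition poly_growth (r : nat) (F : 'rV[int]_r -> int) : Prop :=
  exists C c : nat, forall N : nat, (0 < N)%N -> forall h : 'rV[int]_r,
    (forall j, (`|h ord0 j| <= N)%N) -> (`|F h| <= C * N ^ c)%N.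

(** These properties serve the fibre bound: congruences make the differences [n_i - n_(i+1)] divide
    the value of [G], and growth makes the divisor bound [O(N^eps)]. *)
Definition poly_like (r : nat) (F : 'rV[int]_r -> int) : Prop :=
  congruence_preserving F /\ poly_growth F.

Lemma eq_poly_like r (F F' : 'rV[int]_r -> int) :
  F =1 F' -> poly_like F -> poly_like F'.
Proof.
move=> FF' [cF [C [c gF]]]; split=> [m h h' mh|]; first by rewrite -!FF'; apply: cF.
by exists C, c => N N0 h hN; rewrite -FF'; apply: gF.
Qed.

Lemma poly_like_cst r a : poly_like (fun _ : 'rV[int]_r => a).
Proof.
split=> [m h h' _|]; first by rewrite subrr dvdz0.
by exists `|a|%N, 0%N => N _ h _; rewrite muln1.
Qed.

Lemma poly_like_coord r (j : 'I_r) : poly_like (fun h : 'rV[int]_r => h ord0 j).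
Proof.
split=> [m h h' //|]; exists 1%N, 1%N => N _ h hN.
by rewrite mul1n expn1.
Qed.

Lemma poly_likeD r (F F' : 'rV[int]_r -> int) :
  poly_like F -> poly_like F' -> poly_like (fun h => F h + F' h).
Proof.
move=> [cF [C [c gF]]] [cF' [C' [c' gF']]]; split=> [m h h' mh|].
  by rewrite opprD addrACA rpredD //; [apply: cF | apply: cF'].
exists (C + C')%N, (c + c')%N => N N0 h hN.
apply: (@leq_trans (`|F h| + `|F' h|)%N); first by lia.
rewrite mulnDl leq_add //.
  by apply: leq_trans (gF _ N0 _ hN) _; rewrite leq_mul2l leq_pexp2l ?leq_addr ?orbT.
by apply: leq_trans (gF' _ N0 _ hN) _; rewrite leq_mul2l leq_pexp2l ?leq_addl ?orbT.
Qed.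

Lemma poly_likeM r (F F' : 'rV[int]_r -> int) :
  poly_like F -> poly_like F' -> poly_like (fun h => F h * F' h).
Proof.
move=> [cF [C [c gF]]] [cF' [C' [c' gF']]]; split=> [m h h' mh|].
  have -> : F h * F' h - F h' * F' h' = (F h - F h') * F' h + F h' * (F' h - F' h') by ring.
  by rewrite rpredD //; [apply: dvdz_mulr; apply: cF | apply: dvdz_mull; apply: cF'].
exists (C * C')%N, (c + c')%N => N N0 h hN.
by rewrite abszM expnD mulnACA leq_mul // ?gF ?gF'.
Qed.

Lemma poly_like_sum r (I : Type) (s : seq I) (F : I -> 'rV[int]_r -> int) :
  (forall i, poly_like (F i)) -> poly_like (fun h => \sum_(i <- s) F i h).
Proof.
move=> HF; elim: s => [|i s IH].
  by apply: eq_poly_like (poly_like_cst r 0) => h; rewrite big_nil.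
by apply: eq_poly_like (poly_likeD (HF i) IH) => h; rewrite big_cons.
Qed.

Lemma poly_like_prod r (I : Type) (s : seq I) (F : I -> 'rV[int]_r -> int) :
  (forall i, poly_like (F i)) -> poly_like (fun h => \prod_(i <- s) F i h).
Proof.
move=> HF; elim: s => [|i s IH].
  by apply: eq_poly_like (poly_like_cst r 1) => h; rewrite big_nil.
by apply: eq_poly_like (poly_likeM (HF i) IH) => h; rewrite big_cons.
Qed.

Lemma poly_like_horner r (F : 'rV[int]_r -> int) (p : {poly int}) :
  poly_like F -> poly_like (fun h => p.[F h]).
Proof.
move=> HF; elim/poly_ind: p => [|p c IH].
  by apply: eq_poly_like (poly_like_cst r 0) => h; rewrite horner0.
apply: eq_poly_like (poly_likeD (poly_likeM IH HF) (poly_like_cst r c)) => h.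
by rewrite !hornerE.
Qed.

(** * Polynomials spanned by products of one-variable polynomials *)

Section TensorPoly.
Variables (r d : nat) (W : 'I_r -> 'I_d.+1 -> {poly int}).

(** There are [(d + 1) ^ r] free coefficients [g]. The factors [W] stay arbitrary so that they can
    be a Newton basis adapted to a lattice. *)
Definition tensor_poly (g : {ffun 'I_r -> 'I_d.+1} -> int) (h : 'rV[int]_r) : int :=
  \sum_(a : {ffun 'I_r -> 'I_d.+1}) g a * \prod_(j < r) (W j (a j)).[h ord0 j].

Lemma tensor_poly_like g : poly_like (tensor_poly g).
Proof.
apply: poly_like_sum => a; apply: poly_likeM; first exact: poly_like_cst.
by apply: poly_like_prod => j; apply: poly_like_horner; apply: poly_like_coord.
Qed.

Lemma size_prod_pred (I : Type) (s : seq I) (F : I -> {poly int}) :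
  ((size (\prod_(i <- s) F i)%R).-1 <= \sum_(i <- s) (size (F i)).-1)%N.
Proof.
elim: s => [|i s IH]; first by rewrite big_nil size_poly1.
rewrite !big_cons; apply: leq_trans (leq_add (leqnn _) IH).
by have := size_polyMleq (F i) (\prod_(j <- s) F j)%R; lia.
Qed.

Hypothesis szW : forall j k, (size (W j k) <= d.+1)%N.

Lemma tensor_poly_line g (b : 'rV[int]_r) (c : 'I_r -> {poly int}) :
  exists2 p : {poly int}, (size p <= (d * \sum_(j < r) (size (c j)).-1).+1)%N &
    forall t : int, tensor_poly g (b + \row_j (c j).[t]) = p.[t].
Proof.
exists (\sum_(a : {ffun 'I_r -> 'I_d.+1})
    (g a)%:P * \prod_(j < r) (W j (a j) \Po ((b ord0 j)%:P + c j))).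
  apply: (leq_trans (size_sum _ _ _)); apply/bigmax_leqP => a _.
  rewrite mul_polyC; apply: (leq_trans (size_scale_leq _ _)).
  apply: leq_trans (leqSpred _) _; rewrite ltnS.
  apply: leq_trans (size_prod_pred _ _) _.
  rewrite big_distrr /=; apply: leq_sum => j _.
  have szbc : ((size ((b ord0 j)%:P + c j)%R).-1 <= (size (c j)).-1)%N.
    have := size_polyD (b ord0 j)%:P (c j); have := size_polyC_leq1 (b ord0 j).
    by case: (size (c j)) => [|[|n]]; lia.
  have szWj : ((size (W j (a j))).-1 <= d)%N by have := szW j (a j); lia.
  apply: leq_trans (leq_mul szWj szbc).
  by rewrite -subn1 leq_subLR add1n size_comp_poly_leq.
move=> t; rewrite /tensor_poly horner_sum; apply: eq_bigr => a _.
rewrite hornerM hornerC horner_prod; congr (_ * _); apply: eq_bigr => j _.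
by rewrite horner_comp !hornerE !mxE.
Qed.

Lemma tensor_poly_along g (c : 'I_r -> {poly int}) :
  poly_along (fun n : nat => \row_j (c j).[n%:Z]) (d * \sum_(j < r) (size (c j)).-1)
    (tensor_poly g).
Proof.
move=> b; split.
  by have [p szp Hp] := tensor_poly_line g b c; exists p => // t; rewrite -Hp.
have [p szp Hp] := tensor_poly_line g b (fun j => - c j); exists p => [|t].
  by under eq_bigr do rewrite -size_polyN.
rewrite -Hp; congr tensor_poly; apply/rowP => j; rewrite !mxE.
by rewrite hornerN.
Qed.

End TensorPoly.

(** * Integer solutions of linear systems *)

Lemma rat_common_denom (I : finType) (x : I -> rat) :
  exists2 a : int, a != 0 & exists y : I -> int, forall i, a%:~R * x i = (y i)%:~R.
Proof.
exists (\prod_i denq (x i)).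
  by apply/prodf_neq0 => i _; apply: denq_neq0.
exists (fun i => numq (x i) * \prod_(j | j != i) denq (x j)) => i.
rewrite (bigD1 i) //= !rmorphM /= mulrAC; congr (_ * _).
by rewrite -[x in _ * x]divq_num_den mulrC divfK // intr_eq0 denq_neq0.
Qed.

(** With fewer equations than unknowns the rational matrix has a nonzero kernel vector; clearing
    denominators makes it integral. *)
Lemma int_linear_system (I : finType) (T : eqType) (s : seq T) (A : T -> I -> int) :
    (size s < #|I|)%N ->
  exists2 g : I -> int, exists i, g i != 0 &
    forall t, t \in s -> \sum_i g i * A t i = 0.
Proof.
move=> sI.
pose M := \matrix_(i < #|I|, k < size s) (A (tnth (in_tuple s) k) (enum_val i))%:~R : 'M[rat]_(_, _).
have : kermx M != 0.
  rewrite kermx_eq0 -row_leq_rank -ltnNge.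
  exact: leq_ltn_trans (rank_leq_col M) sI.
move=> /rowV0Pn [v vM v0].
have {}vM : v *m M = 0 by apply/eqP; rewrite -sub_kermx.
have [a a0 [y ya]] := rat_common_denom (fun i : 'I_#|I| => v ord0 i).
exists (fun i => y (enum_rank i)).
  have [i vi] : exists i, v ord0 i != 0.
    by apply/rV0Pn.
  exists (enum_val i); rewrite enum_valK.
  by rewrite -(intr_eq0 rat) -ya mulf_neq0 // intr_eq0.
move=> t /(nthP t) [k ks kt].
apply: (@intr_inj rat); rewrite rmorph_sum rmorph0 /=.
have /(congr1 (fun w : 'rV_ _ => a%:~R * w ord0 (Ordinal ks))) := vM.
rewrite !mxE mulr0 => vt0; apply: etrans vt0; rewrite mulr_sumr.
rewrite [RHS](reindex enum_rank) /=; last by apply: onW_bij; apply: enum_rank_bij.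
apply: eq_bigr => i _; rewrite !mxE (tnth_nth t) /= kt enum_rankK.
by rewrite rmorphM /= -ya mulrA.
Qed.

(** * A polynomial vanishing on alternating sums of curve points *)

Definition curve (r : nat) (gamma : 'I_r -> {poly int}) (n : nat) : 'rV[int]_r :=
  \row_j (gamma j).[n%:Z].

(** * A lattice inside the set of alternating sums *)

Section EvenAlt.
Variables (V : zmodType) (g : nat -> V).

(** Concatenation adds such sums, so they form a subgroup containing all differences [g a - g b]. *)
Definition even_alt (v : V) : Prop := exists2 s, ~~ odd (size s) & alt g s = v.

Lemma even_altD v w : even_alt v -> even_alt w -> even_alt (v + w).
Proof.
move=> [s os <-] [t ot <-]; exists (s ++ t); first by rewrite size_cat oddD (negPf os).
by rewrite alt_cat (negPf os).
Qed.

Lemma even_altN v : even_alt v -> even_alt (- v).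
Proof.
move=> [s os <-]; have [n] := ubnP (size s); elim: n s os => // n IH [|a [|b s]] //= os sn.
  by exists [::]; rewrite // oppr0.
have [||s' os' s'E] := IH s; first by rewrite negbK in os.
  by rewrite ltnS in sn; apply: ltnW.
exists [:: b, a & s'] => /=; first by rewrite negbK.
by rewrite s'E opprK opprB opprD addrA addrAC.
Qed.

Lemma even_alt_mulz v m : even_alt v -> even_alt (v *~ m).
Proof.
move=> Hv; have Hn n : even_alt (v *+ n).
  elim: n => [|n IH]; first by exists [::]; rewrite // mulr0n.
  by rewrite mulrS; apply: even_altD.
case: m => n; first exact: Hn.
by rewrite NegzE mulrNz; apply: even_altN; apply: Hn.
Qed.

Lemma even_alt_sum (I : Type) (s : seq I) (F : I -> V) :
  (forall i, even_alt (F i)) -> even_alt (\sum_(i <- s) F i).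
Proof.
move=> HF; elim: s => [|i s IH]; first by exists [::]; rewrite // big_nil.
by rewrite big_cons; apply: even_altD.
Qed.

Lemma even_alt_sub a b : even_alt (g a - g b).
Proof. by exists [:: a; b]; rewrite //= subr0. Qed.

End EvenAlt.

Section Dominance.
Variables (r : nat) (gamma : 'I_r -> {poly int}).
Hypothesis deg_gt0 : forall i, (1 < size (gamma i))%N.
Hypothesis deg_lt : forall i j : 'I_r, (i < j)%N -> (size (gamma i) < size (gamma j))%N.

Let k := (\max_(j < r) size (gamma j))%N.

(** A kernel vector [v] gives a combination [P] of the [gamma j - (gamma j).[0]] with [k] roots and
    size at most [k], so [P = 0]. But the largest [j] with [v_j != 0] contributes a leading term
    that no smaller degree can cancel. *)
Lemma curve_row_full :
  row_full (\matrix_(t < k, j < r) ((gamma j).[t%:Z] - (gamma j).[0])%:~R : 'M[rat]_(k, r)).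
Proof.
set V := (\matrix_(_, _) _).
rewrite -cokermx_eq0; apply: contraT => C0.
have /rowV0Pn[v /submxP[B vB] v0] : (cokermx V)^T != 0 by rewrite trmx_eq0.
have Vv : V *m v^T = 0 by rewrite vB trmx_mul trmxK mulmxA mulmx_coker mul0mx.
pose q j := gamma j - (gamma j).[0]%:P.
pose P : {poly rat} := \sum_j v ord0 j *: map_poly intr (q j).
have szq j : (size (q j) <= size (gamma j))%N.
  apply: leq_trans (size_polyD _ _) _; rewrite size_polyN geq_max leqnn /=.
  by apply: leq_trans (size_polyC_leq1 _) _; apply: ltnW.
have szP : (size P <= k)%N.
  apply: leq_trans (size_sum _ _ _) _; apply/bigmax_leqP => j _.
  apply: leq_trans (size_scale_leq _ _) _; apply: leq_trans (size_poly _ _) _.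
  by apply: leq_trans (szq j) _; apply: (leq_bigmax j).
have P0 : P = 0.
  apply: contraTeq szP => P0; rewrite -ltnNge.
  rewrite -[k](size_iota 0) -(size_map (fun t : nat => t%:Z%:~R : rat)).
  apply: max_poly_roots => //; last first.
    by rewrite map_inj_uniq ?iota_uniq // => x y /intr_inj [].
  apply/allP => _ /mapP[t tk ->]; rewrite mem_iota /= add0n in tk.
  have := congr1 (fun M : 'cV_k => M (Ordinal tk) ord0) Vv.
  rewrite !mxE => Vt; apply/rootP; apply: etrans Vt.
  rewrite horner_sum; apply: eq_bigr => j _.
  by rewrite !mxE hornerZ horner_map /= !hornerE mulrC.
have /rV0Pn[j0 vj0] := v0.
case: (@arg_maxnP _ j0 (fun j => v ord0 j != 0) val vj0) => j vj jmax.
have := congr1 (fun p : {poly rat} => p`_(size (gamma j)).-1) P0.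
rewrite coef0 coef_sum (bigD1 j) //= big1 => [|l lj].
  rewrite addr0 coefZ coef_map /= coefB coefC.
  have -> : ((size (gamma j)).-1 == 0)%N = false by have := deg_gt0 j; lia.
  rewrite subr0 => /eqP; rewrite mulf_eq0 (negPf vj) intr_eq0 -lead_coefE lead_coef_eq0.
  by rewrite -size_poly_eq0; have := deg_gt0 j; case: (size _).
have [->|vl] := eqVneq (v ord0 l) 0; first by rewrite scale0r coef0.
have ljlt : (l < j)%N by rewrite ltn_neqAle lj; apply: jmax.
rewrite coefZ nth_default ?mulr0 //; apply: leq_trans (size_poly _ _) _.
apply: leq_trans (szq l) _; rewrite -ltnS prednK ?deg_lt //.
exact: ltnW (deg_gt0 j).
Qed.

(** A left inverse of the difference matrix writes each unit vector as a rational combination of the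
    vectors [curve gamma t - curve gamma 0]; [a] clears the denominators. *)
Lemma even_alt_lattice : exists2 a : int, a != 0 &
  forall b : 'rV[int]_r, even_alt (curve gamma) (a *: b).
Proof.
have /row_fullP[U UV] := curve_row_full.
have [a a0 [y ya]] := rat_common_denom (fun ij : 'I_r * 'I_k => U ij.1 ij.2).
exists a => // b.
have evenZ m (v : 'rV[int]_r) : even_alt (curve gamma) v -> even_alt (curve gamma) (m *: v).
  by rewrite -[m]intz scaler_int; apply: even_alt_mulz.
have -> : a *: b = \sum_(j < r) b ord0 j *: \sum_(t < k) y (j, t) *: (curve gamma t - curve gamma 0%N).
  apply/rowP => l; rewrite !mxE !summxE.
  apply: (@intr_inj rat); rewrite rmorphM rmorph_sum /=.
  transitivity (\sum_(j < r) (b ord0 j)%:~R * (a%:~R * (j == l)%:R) : rat).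
    rewrite (bigD1 l) //= big1 ?addr0 => [|j /negPf ->]; last by rewrite !mulr0.
    by rewrite eqxx mulr1 mulrC.
  apply: eq_bigr => j _; rewrite mxE rmorphM /=; congr (_ * _).
  rewrite summxE rmorph_sum /=.
  have := congr1 (fun M : 'M_r => a%:~R * M j l) UV; rewrite !mxE => <-.
  rewrite mulr_sumr; apply: eq_bigr => t _.
  by rewrite !mxE rmorphM /= -ya mulrA.
apply: even_alt_sum => j; apply/evenZ; apply: even_alt_sum => t.
by apply: evenZ; apply: even_alt_sub.
Qed.

Lemma alt_lattice (e : bool) : exists (a : int) (c : 'rV[int]_r), a != 0 /\
  forall b, exists2 s, odd (size s) = e & alt (curve gamma) s = c + a *: b.
Proof.
have [a a0 Ha] := even_alt_lattice; case: e; last first.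
  exists a, 0; split=> // b; have [s os sE] := Ha b.
  by exists s; [apply: negbTE | rewrite add0r].
exists a, (curve gamma 0%N); split=> // b; have [s os sE] := Ha (- b).
by exists (0%N :: s); rewrite //= sE scalerN opprK.
Qed.

End Dominance.

(** * Nonvanishing on a lattice coset *)

Section NewtonBasis.
Variables (r d : nat) (a : int) (c : 'rV[int]_r).
Hypothesis a0 : a != 0.

(** The nodes are coordinates of points of [c + a Z^r], so the nonvanishing point found below lies
    in the coset filled by alternating sums. *)
Definition newton_poly (j : 'I_r) (n : 'I_d.+1) : {poly int} :=
  \prod_(i < n) ('X - (c ord0 j + a * i%:Z)%:P).

Lemma size_newton_poly j n : (size (newton_poly j n) <= d.+1)%N.
Proof. by rewrite size_prod_XsubC /index_enum -enumT size_enum_ord. Qed.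

Lemma newton_poly_eq0 j (n m : 'I_d.+1) :
  ((newton_poly j n).[c ord0 j + a * m%:Z] == 0) = (m < n)%N.
Proof.
rewrite horner_prod; apply/prodf_eq0/idP => [[i _]|mn].
  rewrite hornerXsubC opprD addrACA subrr add0r -mulrBr mulf_eq0 (negPf a0) /=.
  by rewrite subr_eq0 => /eqP[->].
by exists (Ordinal mn); rewrite // hornerXsubC subrr.
Qed.

(* At the node of an index [al] of minimal weight in the support of [g], every
   other term vanishes. *)
Lemma tensor_newton_neq0 (g : {ffun 'I_r -> 'I_d.+1} -> int) i : g i != 0 ->
  exists b : 'rV[int]_r, tensor_poly newton_poly g (c + a *: b) != 0.
Proof.
move=> gi.
pose w (al : {ffun 'I_r -> 'I_d.+1}) := (\sum_j al j)%N.
case: (@arg_minnP _ i (fun al => g al != 0) w gi) => al gal almin.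
exists (\row_j (al j)%:Z).
have E j be : (newton_poly j be).[(c + a *: \row_j (al j)%:Z) ord0 j] =
    (newton_poly j be).[c ord0 j + a * (al j)%:Z].
  by rewrite !mxE.
rewrite /tensor_poly (bigD1 al) //= [X in _ + X]big1 => [|be beal].
  rewrite addr0 mulf_neq0 //; apply/prodf_neq0 => j _.
  by rewrite E newton_poly_eq0 ltnn.
have [->|gbe] := eqVneq (g be) 0; first by rewrite mul0r.
(* Otherwise [be <= al] coordinatewise, and minimality of the weight of [al] forces equality. *)
have [j alj] : exists j, (al j < be j)%N.
  apply/existsP; apply: contraNT beal => /existsPn H.
  have le j : (be j <= al j)%N by rewrite leqNgt.
  apply/eqP/ffunP => j; apply/val_inj/eqP => /=.
  have [le_sum] := leqif_sum (fun j (_ : true) => leqif_eq (le j)).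
  rewrite eqn_leq le_sum (almin be gbe) => /esym/forallP/(_ j) /=.
  by [].
rewrite (bigD1 j) //= E.
have -> : (newton_poly j (be j)).[c ord0 j + a * (al j)%:Z] = 0.
  by apply/eqP; rewrite newton_poly_eq0.
by rewrite mul0r mulr0.
Qed.

End NewtonBasis.

Lemma vanishing_polynomial (r : nat) (gamma : 'I_r -> {poly int}) :
    (0 < r)%N -> (forall i, (1 < size (gamma i))%N) ->
    (forall i j : 'I_r, (i < j)%N -> (size (gamma i) < size (gamma j))%N) ->
  exists (G : 'rV[int]_r -> int) (K L : nat),
    [/\ poly_along (curve gamma) K G, poly_like G, (r <= L.+1)%N,
      forall s, size s = L -> G (alt (curve gamma) s) = 0 &
      exists2 s, size s = L.+2 & G (alt (curve gamma) s) != 0].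
Proof.
move=> r0 deg0 deglt.
(* The parity of [r.-1] is imposed because lengths will change by two at a time. *)
have [a [c [a0 Hc]]] := alt_lattice deg0 deglt (odd r.-1).
pose D := (\sum_(j < r) (size (gamma j)).-1)%N.
(* With this [d] the system has fewer equations than unknowns: [(K + 1) ^ (r - 1) <= (D (d + 1)) ^
   (r - 1) = d (d + 1) ^ (r - 1) < (d + 1) ^ r]. *)
pose d := (D ^ r.-1)%N; pose K := (d * D)%N.
pose W := @newton_poly r d a c.
have [|g [i gi] gs] := @int_linear_system {ffun 'I_r -> 'I_d.+1} _
    (tuples (iota 0 K.+1) r.-1)
    (fun s al => \prod_(j < r) (W j (al j)).[(alt (curve gamma) s) ord0 j]).
  rewrite size_tuples size_iota card_ffun !card_ord.
  have D0 : (0 < D)%N.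
    by rewrite /D (bigD1 (Ordinal r0)) //= addn_gt0 -subn1 subn_gt0 deg0.
  apply: (@leq_ltn_trans ((D * d.+1) ^ r.-1)%N).
    by rewrite leq_expl // /K; lia.
  by rewrite expnMn -/d -[in ltnRHS](prednK r0) expnS ltn_pmul2r ?expn_gt0.
pose G := tensor_poly W g.
have alG : poly_along (curve gamma) K G.
  by apply: tensor_poly_along => j n; apply: size_newton_poly.
have G0 s : size s = r.-1 -> G (alt (curve gamma) s) = 0.
  move: s; apply: sep_poly_grid0 (sep_poly_alt _ alG) _ => s /gs <-.
  by [].
have [b Gb] := tensor_newton_neq0 c a0 gi.
have [s0 os0 s0E] := Hc b.
have pad s m : alt (curve gamma) (s ++ nseq m.*2 0%N) = alt (curve gamma) s.
  rewrite alt_cat; have -> : alt (curve gamma) (nseq m.*2 0%N) = 0.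
    by elim: m => [|m IH] //; rewrite doubleS /= IH subr0 subrr.
  by rewrite oppr0 if_same addr0.
have [j [s1 [s1j Gs1]]] : exists j s, size s = (r.-1 + j.*2)%N /\ G (alt (curve gamma) s) != 0.
  exists ((size s0 + r.*2 - r.-1)./2), (s0 ++ nseq r.*2 0%N); rewrite pad s0E; split=> //.
  rewrite size_cat size_nseq.
  by move: os0; lia.
(* Descend by two until [G] vanishes on the grid, hence on all sequences, of the shorter length.
   Length [r.-1] stops the descent. *)
elim: j s1 s1j Gs1 => [|j IH] s1 s1j Gs1.
  by rewrite G0 ?eqxx // s1j addn0 in Gs1.
have [/hasP[s]|/hasPn no] := boolP (has (fun s => G (alt (curve gamma) s) != 0)
    (tuples (iota 0 K.+1) (r.-1 + j.*2))).
  by rewrite mem_tuples => /andP[/eqP sj _]; apply: IH.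
exists G, K, (r.-1 + j.*2)%N; split=> //.
- exact: tensor_poly_like.
- lia.
- apply: sep_poly_grid0 (sep_poly_alt _ alG) _ => s /no /negPn/eqP.
  by [].
- by exists s1 => //; rewrite s1j doubleS !addnS.
Qed.

(** * Fibres of alternating sums *)

Lemma coef_comp_XaddC (R : comNzRingType) (p : {poly R}) (c : R) m :
  (p \Po ('X + c%:P))`_m = (p^`N(m)).[c].
Proof.
elim/poly_ind: p m => [|p a IH] m.
  by rewrite comp_poly0 coef0 raddf0 horner0.
rewrite comp_polyD comp_polyM comp_polyX comp_polyC mulrDr !coefD coefC coefMX coefMC.
case: m => [|m] /=.
  by rewrite add0r IH !nderivn0 hornerMXaddC.
by rewrite !IH nderivnMXaddC !hornerE.
Qed.

Lemma lead_coef_comp_XaddC (p : {poly int}) (c : int) k : size p = k.+1 ->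
  (p \Po ('X + c%:P))`_k = lead_coef p.
Proof.
move=> szp; rewrite coef_comp_XaddC (@horner_coef_wide _ 1%N); last first.
  by apply/leq_sizeP => i i1; rewrite coef_nderivn nth_default ?mul0rn // szp; lia.
by rewrite big_ord1 coef_nderivn addn0 binn mulr1n mulr1 lead_coefE szp.
Qed.

Lemma subleading_coef_comp_XaddC (p : {poly int}) (c : int) k : size p = k.+2 ->
  (p \Po ('X + c%:P))`_k = p`_k + c * (k.+1%:R * lead_coef p).
Proof.
move=> szp; rewrite coef_comp_XaddC (@horner_coef_wide _ 2%N); last first.
  by apply/leq_sizeP => i i1; rewrite coef_nderivn nth_default ?mul0rn // szp; lia.
rewrite big_ord_recr big_ord1 /= !coef_nderivn addn0 binn mulr1n mulr1 addn1 binSn lead_coefE szp.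
rewrite -mulr_natr. ring.
Qed.

Lemma alt_cst (A : Type) (V : zmodType) (v : V) (s : seq A) :
  alt (fun _ => v) s = if odd (size s) then v else 0.
Proof. by elim: s => //= a s ->; case: (odd _); rewrite /= ?subrr ?subr0. Qed.

Lemma alt_add (A : Type) (V : zmodType) (f g : A -> V) (s : seq A) :
  alt (fun a => f a + g a) s = alt f s + alt g s.
Proof. by elim: s => [|a s IH] /=; rewrite ?addr0 // IH opprD addrACA. Qed.

Lemma alt_mulr (A : Type) (R : pzRingType) (f : A -> R) (c : R) (s : seq A) :
  alt (fun a => f a * c) s = alt f s * c.
Proof. by elim: s => [|a s IH] /=; rewrite ?mul0r // IH mulrBl. Qed.

(* The top coefficient survives when the number of terms is odd, the next one
   (proportional to [alt id o]) when it is even. *)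
Lemma alt_shift_nonconst (p : {poly int}) (o : seq int) (c : int) :
    (2 < size p)%N -> odd (size o) || (alt id o != 0) ->
  alt (fun x => p \Po ('X + x%:P)) o - c%:P != 0.
Proof.
move=> p2 Ho; set q := alt _ o.
have [k szp] : exists k, size p = k.+3 by exists (size p - 3)%N; lia.
have p0 : lead_coef p != 0 by rewrite lead_coef_eq0 -size_poly_eq0 szp.
have qE m : q`_m = alt (fun x => (p \Po ('X + x%:P))`_m) o.
  by rewrite /q -[LHS]/(coefp m _) alt_map.
suff [m m0 qm] : exists2 m, (0 < m)%N & q`_m != 0.
  apply/eqP => /(congr1 (fun q : {poly int} => q`_m)) /eqP.
  by rewrite coefB coefC coef0 (gtn_eqF m0) subr0 (negPf qm).
have [oo|eo] := boolP (odd (size o)).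
  exists k.+2 => //; rewrite qE (eq_alt (fun x => lead_coef_comp_XaddC x szp)).
  by rewrite alt_cst oo.
(* Degree at least 2 keeps this index positive, away from the constant [c]. *)
exists k.+1 => //; rewrite qE (eq_alt (fun x => subleading_coef_comp_XaddC x szp)).
rewrite alt_add alt_cst (negPf eo) add0r alt_mulr mulf_neq0 //.
  by rewrite (negPf eo) in Ho.
by rewrite mulf_neq0 // pnatr_eq0.
Qed.

Lemma size_alt_shift (p : {poly int}) (o : seq int) :
  (size (alt (fun x => p \Po ('X + x%:P)) o) <= size p)%N.
Proof.
elim: o => [|x o IH] /=; first by rewrite size_poly0.
apply: leq_trans (size_polyD _ _) _; rewrite size_polyN geq_max IH andbT.
by rewrite size_comp_poly2 // size_XaddC.
Qed.

Lemma alt_map_add (t : int) (o : seq int) : ~~ odd (size o) ->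
  alt id [seq t + x | x <- o] = alt id o.
Proof. by move=> eo; rewrite alt_comp alt_add alt_cst (negPf eo) add0r. Qed.

(** * Sequences recovered from their differences *)

Definition steps (s : seq nat) : seq int :=
  if map Posz s is x :: s' then pairmap (fun x y => x - y) x s' else [::].

(** The sequence with differences [ds] normalised to start at 0; all others are its translates. *)
Definition unsteps (ds : seq int) : seq int :=
  0 :: scanl (fun x d => x - d) 0 ds.

Lemma stepsK t s : map Posz (t :: s) = [seq t%:Z + x | x <- unsteps (steps (t :: s))].
Proof.
rewrite /unsteps /= addr0; congr cons.
have E u ds : [seq t%:Z + x | x <- scanl (fun x d => x - d) u ds] =
    scanl (fun x d => x - d) (t%:Z + u) ds.
  by elim: ds u => //= d ds IH u; rewrite IH addrA.
rewrite E addr0 pairmapK // => x y /=.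
by rewrite opprB addrC subrK.
Qed.

Lemma size_steps s : size (steps s) = (size s).-1.
Proof. by case: s => // t s; rewrite /steps /= size_pairmap size_map. Qed.

Definition int_divisors (m : nat) : seq int :=
  map Posz (divisors m) ++ map (fun d => - Posz d) (divisors m).

Lemma mem_int_divisors (m d : int) : m != 0 -> (d %| m)%Z -> d \in int_divisors `|m|.
Proof.
move=> m0 dm; rewrite mem_cat.
have dv : `|d|%N \in divisors `|m| by rewrite -dvdn_divisors ?absz_gt0.
case: d dm dv => n _ dv; apply/orP; first by left; apply: (map_f Posz dv).
by right; apply/mapP; exists n.+1 => //; rewrite NegzE.
Qed.

Section Fibres.
Variables (r : nat) (gamma : 'I_r -> {poly int}).
Variables (G : 'rV[int]_r -> int) (L : nat) (j0 : 'I_r).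
Hypothesis G_poly : poly_like G.
Hypothesis G_vanish : forall s, size s = L -> G (alt (curve gamma) s) = 0.
Hypothesis top_deg : (2 < size (gamma j0))%N.

(** The first condition makes the divisor bound available; the second keeps the polynomial satisfied
    by the first entry nonconstant when the length is even. *)
Definition generic_walk (s : seq nat) : bool :=
  (G (alt (curve gamma) s) != 0) && (alt Posz s != 0).

Lemma dvdz_horner_sub (p : {poly int}) (a b : int) : (a - b %| p.[a] - p.[b])%Z.
Proof.
have /factor_theorem[q qE] : root (p - p.[b]%:P) b by rewrite rootE !hornerE subrr.
have -> : p.[a] - p.[b] = (p - p.[b]%:P).[a] by rewrite !hornerE.
by rewrite qE hornerM hornerXsubC dvdz_mull.
Qed.

(* Replacing [a] by [b] changes [G] by a multiple of [a - b] and makes two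
   consecutive terms cancel, leaving an alternating sum of length [L]. *)
Lemma step_dvd s1 a b s2 : size (s1 ++ [:: a, b & s2]) = L.+2 ->
  (a%:Z - b%:Z %| G (alt (curve gamma) (s1 ++ [:: a, b & s2])))%Z.
Proof.
move=> szs; set s := _ ++ _ in szs *.
have G0 : G (alt (curve gamma) (s1 ++ [:: b, b & s2])) = 0.
  have -> : alt (curve gamma) (s1 ++ [:: b, b & s2]) = alt (curve gamma) (s1 ++ s2).
    by rewrite !alt_cat /= subKr.
  by apply: G_vanish; move: szs; rewrite /s !size_cat /=; lia.
rewrite -[G _]subr0 -G0; apply: G_poly.1 => j.
rewrite /s !alt_cat; case: (odd _) => /=; rewrite !mxE.
  rewrite [X in (_ %| X)%Z](_ : _ = - ((gamma j).[a] - (gamma j).[b])); last by ring.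
  by rewrite rpredN; apply: dvdz_horner_sub.
rewrite [X in (_ %| X)%Z](_ : _ = (gamma j).[a] - (gamma j).[b]); last by ring.
exact: dvdz_horner_sub.
Qed.

Lemma steps_divisors s d : size s = L.+2 -> d \in steps s ->
  (d %| G (alt (curve gamma) s))%Z.
Proof.
move=> szs ds.
have [s1 [a [b [s2 [sE dE]]]]] : exists s1 a b s2, s = s1 ++ [:: a, b & s2] /\ d = a%:Z - b%:Z.
  case: s {szs} ds => // a s; elim: s a => // b s IH a; rewrite inE => /predU1P[->|dbs].
    by exists [::], a, b, s.
  have [s1 [a' [b' [s2 [sE dE]]]]] := IH b dbs.
  by exists (a :: s1), a', b', s2; rewrite sE.
by rewrite sE in szs *; rewrite dE; apply: step_dvd.
Qed.

(** Once the differences are fixed only the first entry is free, and coordinate [j0] makes it a root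
    of the nonzero polynomial [q]. *)
Lemma fibre_steps (ds : seq int) (h : 'rV[int]_r) (Y : seq nat) : uniq Y ->
  (count (fun s => steps s == ds)
    [seq s <- tuples Y L.+2 | generic_walk s && (alt (curve gamma) s == h)]
   <= size (gamma j0))%N.
Proof.
move=> uY; rewrite -size_filter; set F := [seq s <- _ | _].
have uF : uniq F by rewrite !filter_uniq ?uniq_tuples.
have inF s : s \in F -> [/\ steps s = ds, size s = L.+2, alt Posz s != 0 & alt (curve gamma) s = h].
  rewrite !mem_filter mem_tuples.
  by move=> /andP[/eqP -> /andP[/andP[/andP[_ ->] /eqP ->] /andP[/eqP -> _]]].
have sE s : s \in F -> map Posz s = [seq (head 0%N s)%:Z + x | x <- unsteps ds].
  by move=> /inF[<- + _ _]; case: s => // t s _; apply: stepsK.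
have [->//|[s0 s0F]] : F = [::] \/ exists s, s \in F.
  by case: (F) => [|s F']; [left | right; exists s; rewrite mem_head].
rewrite -(size_map (head 0%N)).
pose q := alt (fun x => gamma j0 \Po ('X + x%:P)) (unsteps ds) - (h ord0 j0)%:P.
have q0 : q != 0.
  apply: alt_shift_nonconst => //.
  have [_ _ a0 _] := inF _ s0F.
  (* An alternating sum of even length is translation invariant, so it can be read off from the
     member [s0] of the fibre. *)
  case: (boolP (odd (size (unsteps ds)))) => [//|eo]; rewrite orFb.
  rewrite -(alt_map_add (head 0%N s0)%:Z) // -(sE s0 s0F) alt_comp.
  exact: a0.
apply: ltnW; apply: (@leq_trans (size q)).
  apply: size_nat_roots => //.
    rewrite map_inj_in_uniq // => s t sF tF st.
    by apply: (inj_map (fun x y => fun e : Posz x = Posz y => congr1 absz e)); rewrite (sE s) // (sE t) // st.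
  apply/allP => _ /mapP[s sF ->]; have [_ _ _ sh] := inF _ sF.
  rewrite hornerD hornerN hornerC subr_eq0 -sh; apply/eqP.
  have -> : alt (curve gamma) s ord0 j0 = alt (fun x => (gamma j0).[x]) (map Posz s).
    rewrite alt_comp; by elim: (s) => [|n s' IH]; rewrite /= !mxE ?IH.
  rewrite (sE s sF) alt_comp -[LHS]/(horner_eval _ _) alt_map.
  by apply: eq_alt => x /=; rewrite /horner_eval /= horner_comp !hornerE.
apply: leq_trans (size_polyD _ _) _; rewrite geq_max size_alt_shift size_polyN /=.
apply: leq_trans (size_polyC_leq1 _) _; exact: ltnW (ltnW _).
Qed.

Lemma fibre_le (h : 'rV[int]_r) (Y : seq nat) : uniq Y ->
  (count (fun s => generic_walk s && (alt (curve gamma) s == h)) (tuples Y L.+2)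
   <= (2 * size (divisors `|G h|)) ^ L.+1 * size (gamma j0))%N.
Proof.
move=> uY; rewrite -size_filter.
set F := [seq s <- _ | _].
apply: leq_trans (size_fibres (f := steps) (u := tuples (int_divisors `|G h|) L.+1) _ _) _.
- move=> s; rewrite mem_filter mem_tuples => /andP[/andP[/andP[Gs _] /eqP sh] /andP[/eqP szs _]].
  rewrite mem_tuples size_steps szs eqxx /=; apply/allP => d ds.
  by apply: mem_int_divisors; rewrite -sh //; apply: steps_divisors.
- by move=> ds _; apply: fibre_steps.
by rewrite size_tuples size_cat !size_map addnn mul2n.
Qed.

End Fibres.

Lemma alt_curve_growth (r : nat) (gamma : 'I_r -> {poly int}) (G : 'rV[int]_r -> int)
    (m : nat) : poly_like G ->
  exists C c : nat, forall N s, (0 < N)%N ->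
  size s = m -> {in s, forall n, n <= N}%N -> (`|G (alt (curve gamma) s)| <= C * N ^ c)%N.
Proof.
move=> [_ [C [c CG]]].
have [C1 [c1 H1]] : exists C c : nat, forall N, (0 < N)%N -> forall n j, (n <= N)%N ->
    (`|(gamma j).[n%:Z]| <= C * N ^ c)%N.
  (* The sum of squares dominates every [gamma j], giving constants uniform in [j]. *)
  pose F (h : 'rV[int]_1) := \sum_(j < r) (gamma j).[h ord0 ord0] * (gamma j).[h ord0 ord0].
  have [_ [C1 [c1 H1]]] : poly_like F.
    apply: poly_like_sum => j.
    by apply: poly_likeM; apply: poly_like_horner; apply: poly_like_coord.
  exists C1, c1 => N N0 n j nN.
  have := H1 N N0 (const_mx n%:Z); rewrite /F !mxE => Hn.
  apply: (leq_trans _ (Hn _)) => [|l]; last by rewrite mxE.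
  have sq x : 0 <= x * x :> int by rewrite -expr2 sqr_ge0.
  rewrite (bigD1 j) //=; set S := \sum_(_ < r | _) _.
  have : 0 <= S by apply: sumr_ge0.
  by move: ((gamma j).[_]) => x; nia.
exists (C * (m * C1).+1 ^ c)%N, (c1 * c)%N => N s N0 sm sN.
rewrite -mulnA expnM -expnMn; apply: CG => [|j].
  by rewrite muln_gt0 expn_gt0 N0.
apply: (@leq_trans (m * (C1 * N ^ c1))%N); last by rewrite mulnA leq_mul2r leqnSn orbT.
rewrite -sm; elim: s sN {sm} => [|n s IH] sN; first by rewrite /= mxE.
rewrite /= !mxE mulSn; apply: (@leq_trans (`|(gamma j).[n%:Z]| + `|alt (curve gamma) s ord0 j|)%N).
  by lia.
apply: leq_add; first by apply: H1 => //; apply: sN; rewrite mem_head.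
by apply: IH => k ks; apply: sN; rewrite inE ks orbT.
Qed.

Lemma generic_walk_avoid (r : nat) (gamma : 'I_r -> {poly int}) (G : 'rV[int]_r -> int) K L s :
    poly_along (curve gamma) K G -> size s = L.+1 -> G (alt (curve gamma) s) != 0 ->
  avoid (K + 1) L.+1 (generic_walk gamma G).
Proof.
move=> GK sL Gs; apply: avoidI; last exact: alt_nonzero_avoid.
exact: sep_poly_avoid (sep_poly_alt _ GK) sL Gs.
Qed.

(** The incidence bound raised to the power [k], so that the loss [N ^ (1/k)] becomes the integer
    [N]. *)
Lemma curve_sum_edges_le (r : nat) (gamma : 'I_r -> {poly int}) (j0 : 'I_r) (k : nat) :
    (forall i, (1 < size (gamma i))%N) ->
    (forall i j : 'I_r, (i < j)%N -> (size (gamma i) < size (gamma j))%N) ->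
    (2 < size (gamma j0))%N -> (0 < k)%N ->
  exists2 C : nat, (0 < C)%N & forall (N : nat) (Y : seq nat) (A B : seq 'rV[int]_r),
    (0 < N)%N -> uniq Y -> {in Y, forall n, n <= N}%N -> uniq A -> uniq B ->
    (sum_edges (curve gamma) Y A B ^ ((2 * r + 1) * k) <=
     C * N * (size Y ^ r * (size A * size B) ^ r.+1) ^ k)%N.
Proof.
move=> deg0 deglt top k0.
have r0 : (0 < r)%N := leq_ltn_trans (leq0n j0) (ltn_ord j0).
have [G [K [L [GK Gp rL Gv [s0 s0L Gs0]]]]] := vanishing_polynomial r0 deg0 deglt.
have avQ := generic_walk_avoid GK s0L Gs0.
have [C1 [c1 H1]] := alt_curve_growth gamma L.+2 Gp.
set sz := size (gamma j0).
(* The [k2]-th power of the divisor count is at most [(D * N) ^ c2]; its [c2]-th root is the needed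
   bound on the power [L.+1 * k]. Taking [c1.+1] keeps the root meaningful when [c1 = 0]. *)
pose c2 := c1.+1; pose k2 := (k * L.+1 * c2)%N.
have k20 : (0 < k2)%N by rewrite !muln_gt0 k0.
pose D := ((k2 ^ k2) ^ (2 ^ k2) * C1.+1)%N.
have D0 : (0 < D)%N by rewrite muln_gt0 expn_gt0 expn_gt0 k20.
pose E := (2 ^ (L.+1 * k) * sz ^ k * D)%N.
have E0 : (0 < E)%N.
  by rewrite muln_gt0 D0 muln_gt0 !expn_gt0 /= /sz (ltnW (ltnW top)).
exists ((16 * (K + 1)) ^ (2 * r.+1 * k) * E)%N => [|N Y A B N0 uY YN uA uB].
  by rewrite muln_gt0 E0 expn_gt0 addn1.
have fib h : (count (fun s => generic_walk gamma G s && (alt (curve gamma) s == h)) (tuples Y L.+2) ^ k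
    <= E * N)%N.
  set cnt := count _ _; have [->|] := posnP cnt; first by rewrite exp0n.
  rewrite -has_count => /hasP[s]; rewrite mem_tuples => /andP[/eqP sL /allP sY] /andP[/andP[Gs _] /eqP sh].
  have Gh : (`|G h| <= C1 * N ^ c1)%N by rewrite -sh; apply: H1 => // n ns; apply: YN; apply: sY.
  have Gh0 : (0 < `|G h|)%N by rewrite absz_gt0 -sh.
  apply: leq_trans (leq_expl k (fibre_le Gp Gv top h _)) _ => //.
  have Dd : (size (divisors `|G h|) ^ (L.+1 * k) <= D * N)%N.
    rewrite -(@leq_exp2r _ _ c2) // -expnM [(L.+1 * k)%N]mulnC -/k2.
    apply: leq_trans (size_divisors_exp_le k20 Gh0) _.
    apply: (@leq_trans (D * N ^ c2)%N); last first.
      by rewrite expnMn leq_mul2r -{1}[D]expn1 leq_pexp2l ?orbT.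
    rewrite /D -mulnA leq_mul2l; apply/orP; right; apply: leq_trans Gh _.
    by rewrite leq_mul // leq_pexp2l.
  rewrite !expnMn -!expnM -/sz /E.
  have -> : (2 ^ (L.+1 * k) * sz ^ k * D * N = 2 ^ (L.+1 * k) * (D * N) * sz ^ k)%N by ring.
  by rewrite leq_mul2r leq_mul2l Dd !orbT.
(* The largest such [c], the integer part of the [k]-th root of [E * N], bounds all fibres at
   once. *)
pose P c := (c ^ k <= E * N)%N.
have exP : exists c, P c by exists 1%N; rewrite /P exp1n muln_gt0 E0.
have ubP c : P c -> (c <= E * N)%N.
  by apply: leq_trans; rewrite -{1}[c]expn1; case: c => [|c]; rewrite ?exp0n // leq_pexp2l.
case: (ex_maxnP exP ubP) => c Pc cmax.
have c0 : (0 < c)%N by apply: cmax; rewrite /P exp1n muln_gt0 E0.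
have K0 : (0 < K + 1)%N by rewrite addn1.
have := @sum_edges_le _ _ _ r _ L.+2 _ _ _ _ uY uA uB K0 c0 rL avQ (fun h => cmax _ (fib h)).
set I := sum_edges _ _ _ _; set W := ((16 * _) ^ _)%N; set ab := (size A * size B)%N => HI.
have := leq_expl k HI.
have -> : ((I ^ (2 * (2 * r + 1))) ^ k = (I ^ ((2 * r + 1) * k)) ^ 2)%N.
  by rewrite -!expnM; congr (_ ^ _)%N; lia.
have sqE w x y : ((w * c ^ 2 * x ^ (2 * r) * y ^ (2 * r.+1)) ^ k =
    w ^ k * (c ^ k * (x ^ r * y ^ r.+1) ^ k) ^ 2)%N.
  by rewrite [(2 * r)%N]mulnC [(2 * r.+1)%N]mulnC !expnM !expnMn; ring.
rewrite sqE.
move=> HIk; rewrite -(@leq_exp2r _ _ 2) //; apply: leq_trans HIk _.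
have -> : ((16 * (K + 1)) ^ (2 * r.+1 * k) = W ^ k)%N by rewrite expnM.
clearbody E; rewrite -!mulnA [leqRHS]expnMn; apply: leq_mul.
  by rewrite -{1}[(W ^ k)%N]expn1 leq_pexp2l // expn_gt0 expn_gt0 muln_gt0 K0.
by rewrite leq_expl // mulnA leq_mul2r; apply/orP; right.
Qed.

(** * From sets to functions *)

Section PowR.
Variable R : realType.
Implicit Types (x y a q : R).

Lemma le_powR x y a : 0 <= a -> 0 <= x -> x <= y -> x `^ a <= y `^ a.
Proof.
by move=> a0 x0 xy; apply: ge0_ler_powR; rewrite // nnegrE // (le_trans x0).
Qed.

Lemma powR_expn x n a : 0 <= x -> (x ^+ n) `^ a = x `^ (n%:R * a).
Proof. by move=> x0; rewrite -powR_mulrn // powRrM. Qed.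

Lemma pow2D x y : 2 `^ (x + y) = 2 `^ x * 2 `^ y :> R.
Proof. by rewrite powRD // pnatr_eq0 implybT. Qed.

Lemma sumr_const_seq (I : Type) (s : seq I) (a : R) :
  \sum_(i <- s) a = (size s)%:R * a.
Proof. by rewrite big_const_seq count_predT iter_addr_0 mulr_natl. Qed.

(** Each term is at most the [q]-norm of the family. *)
Lemma sum_powR_le (I : eqType) (s : seq I) (f : I -> R) q : 0 < q ->
    (forall i, 0 <= f i) ->
  (\sum_(i <- s) f i) `^ q <= (size s)%:R `^ q * \sum_(i <- s) f i `^ q.
Proof.
move=> q0 f0; set S := \sum_(i <- s) f i `^ q.
have S0 : 0 <= S by apply: sumr_ge0 => i _; apply: powR_ge0.
have fS i : i \in s -> f i <= S `^ q^-1.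
  move=> si; have fq : f i `^ q <= S.
    by rewrite /S (big_rem i si) /= lerDl sumr_ge0 // => j _; apply: powR_ge0.
  have := le_powR (_ : 0 <= q^-1) (powR_ge0 _ _) fq.
  by rewrite invr_ge0 (ltW q0) -powRrM divff ?gt_eqF // powRr1 // => ->.
have -> : (size s)%:R `^ q * S = ((size s)%:R * S `^ q^-1) `^ q.
  by rewrite powRM ?powR_ge0 // -powRrM mulVf ?gt_eqF // powRr1.
apply: le_powR; [exact: ltW | exact: sumr_ge0 |].
by rewrite -sumr_const_seq big_seq [leRHS]big_seq ler_sum.
Qed.

End PowR.

(** * From the incidence bound to a strong-type inequality *)

Section StrongType.
Variables (R : realType) (r : nat) (p q W : R).
Variables (V : zmodType) (g : nat -> V) (Y : seq nat).
Hypotheses (r0 : (0 < r)%N) (pr : p * r.+1%:R = (2 * r + 1)%:R)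
  (qr : q * r%:R = (2 * r + 1)%:R) (W1 : 1 <= W) (uY : uniq Y).
Hypothesis edgesW : forall A B : seq V, uniq A -> uniq B ->
  (sum_edges g Y A B)%:R ^+ (2 * r + 1) <= W * (size A * size B)%:R ^+ r.+1.

Let rR0 : 0 < r%:R :> R. Proof. by rewrite ltr0n. Qed.
Let q_gt0 : 0 < q.
Proof. by rewrite -(pmulr_lgt0 _ rR0) qr ltr0n addn1. Qed.
Let p_gt0 : 0 < p.
Proof. by rewrite -(@pmulr_lgt0 _ r.+1%:R) ?ltr0n // pr ltr0n addn1. Qed.
Let W0 : 0 <= W. Proof. exact: le_trans ler01 W1. Qed.
Let qE : q = (2 * r + 1)%:R / r%:R.
Proof. by rewrite -qr mulfK // gt_eqF. Qed.
Let pE : p = (2 * r + 1)%:R / r.+1%:R.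
Proof. by rewrite -pr mulfK // pnatr_eq0. Qed.

Let hits (E : seq V) (x : V) : nat := count (fun n => x + g n \in E) Y.

Let l := (trunc_log 2 (size Y)).+1.

(** Each [x] in [F] carries at least [2 ^ k] incidences; insert this in [edgesW], cancel
    [|F| ^ (r+1)] and take [r]-th roots. *)
Lemma dyadic_piece_le (E F : seq V) k : uniq E -> uniq F ->
    {in F, forall x, 2 ^ k <= hits E x}%N ->
  (size F)%:R * (2 ^+ k) `^ q <= (W * (size E)%:R ^+ r.+1) `^ r%:R^-1.
Proof.
move=> uE uF Fk; have [->|F0] := posnP (size F); first by rewrite mul0r powR_ge0.
have HI : (2 ^ k * size F <= sum_edges g Y F (map -%R E))%N.
  rewrite /sum_edges -[size F]count_predT -iter_addn_0 -big_const_seq.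
  rewrite big_seq [leqRHS]big_seq; apply: leq_sum => x xF.
  apply: leq_trans (Fk x xF) _; rewrite /hits /sum_degree.
  by apply: sub_count => n /= xE; rewrite mem_map //; apply: oppr_inj.
have := edgesW uF (_ : uniq (map -%R E)); rewrite map_inj_uniq; last exact: oppr_inj.
rewrite size_map => /(_ uE) HW.
have nF : 0 < (size F)%:R :> R by rewrite ltr0n.
have key : (2 ^+ k) ^+ (2 * r + 1) * (size F)%:R ^+ r <= W * (size E)%:R ^+ r.+1.
  rewrite -(ler_pM2l (exprn_gt0 r.+1 nF)).
  apply: le_trans (le_trans (_ : _ <= (2 ^ k * size F)%:R ^+ (2 * r + 1)) _) (le_trans HW _).
  - rewrite natrM exprMn natrX mulrCA -exprD.
    by have -> : (r.+1 + r = 2 * r + 1)%N by lia.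
  - by rewrite lerXn2r ?nnegrE // ler_nat.
  - by rewrite natrM exprMn mulrCA.
have := le_powR (_ : 0 <= r%:R^-1) _ key; rewrite invr_ge0 ler0n => /(_ isT).
rewrite mulr_ge0 ?exprn_ge0 // => /(_ isT); apply: le_trans.
rewrite powRM ?exprn_ge0 // !powR_expn ?exprn_ge0 // divff ?gt_eqF // powRr1 //.
by rewrite -qE mulrC -powR_expn.
Qed.

(** Group the points by the dyadic size of [hits], which is at most [|Y|]: there are [l] groups, and
    rounding costs [2 ^ q]. *)
Lemma hits_sum_le (E F : seq V) : uniq E -> uniq F ->
  \sum_(x <- F) (hits E x)%:R `^ q <=
    l%:R * (2 `^ q * (W * (size E)%:R ^+ r.+1) `^ r%:R^-1).
Proof.
move=> uE uF; set Z := _ `^ r%:R^-1.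
pose P k x := ((0 < hits E x) && (trunc_log 2 (hits E x) == k))%N.
apply: (@le_trans _ _ (\sum_(k < l) \sum_(x <- F) if P k x then (hits E x)%:R `^ q else 0)).
  rewrite exchange_big /=; apply: ler_sum => x _.
  have [h0|h0] := posnP (hits E x).
    by rewrite h0 powR0 ?gt_eqF // sumr_ge0 // => k _; case: ifP.
  have kl : (trunc_log 2 (hits E x) < l)%N by rewrite ltnS leq_trunc_log // count_size.
  have PP : P (trunc_log 2 (hits E x)) x by rewrite /P h0 /=.
  rewrite (bigD1 (Ordinal kl)) //= PP lerDl sumr_ge0 // => k _.
  by case: ifP => _; rewrite ?powR_ge0.
rewrite -[l in l%:R]card_ord -sumr_const mulr_suml; apply: ler_sum => k _.
rewrite mul1r -big_mkcond -big_filter; set Fk := [seq _ <- _ | _].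
have inFk x : x \in Fk -> (2 ^ k <= hits E x < 2 ^ k.+1)%N.
  by rewrite mem_filter => /andP[/andP[h0 /eqP <-] _]; apply: trunc_log_bounds.
apply: (@le_trans _ _ (2 `^ q * ((size Fk)%:R * (2 ^+ k) `^ q))).
  rewrite mulrCA -powRM // ?exprn_ge0 // -exprS -sumr_const_seq.
  rewrite big_seq [leRHS]big_seq; apply: ler_sum => x /inFk /andP[_ hk].
  by apply: le_powR; rewrite ?(ltW q_gt0) // -natrX ler_nat ltnW.
rewrite ler_wpM2l ?powR_ge0 //; apply: dyadic_piece_le => //.
  exact: filter_uniq.
by move=> x /inFk /andP[].
Qed.


Lemma level_size_le (f : V -> R) (E : seq V) j :
    (forall x, 0 <= f x) -> \sum_(x <- E) f x `^ p <= 1 ->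
    {in E, forall x, 2 `^ (- j.+1%:R) <= f x} ->
  (size E)%:R <= 2 `^ (j.+1%:R * p).
Proof.
move=> f0 f1 fE; have : (size E)%:R * 2 `^ (- j.+1%:R * p) <= 1.
  apply: le_trans f1; rewrite -sumr_const_seq big_seq [leRHS]big_seq.
  apply: ler_sum => x xE; rewrite powRrM; apply: le_powR; rewrite ?(ltW p_gt0) ?powR_ge0 //.
  exact: fE.
by rewrite mulNr powRN ler_pdivrMr ?powR_gt0 // mul1r.
Qed.

(** Since [p (r + 1) / r = q], the bound on [|E|] yields [2 ^ ((j + 1) q)], which cancels
    [2 ^ (- j q)] up to [2 ^ q]: the estimate is uniform in [j]. *)
Lemma level_piece_le (E F : seq V) j : uniq E -> uniq F ->
    (size E)%:R <= 2 `^ (j.+1%:R * p) :> R ->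
  \sum_(x <- F) (2 `^ (- j%:R) * (hits E x)%:R) `^ q <= l%:R * (4 `^ q * W `^ r%:R^-1).
Proof.
move=> uE uF Ej.
under eq_bigr do rewrite powRM ?powR_ge0 //.
rewrite -mulr_sumr; apply: le_trans (ler_wpM2l (powR_ge0 _ _) (hits_sum_le uE uF)) _.
rewrite mulrCA ler_wpM2l // powRM ?exprn_ge0 //.
have HE : ((size E)%:R ^+ r.+1) `^ r%:R^-1 <= 2 `^ (j.+1%:R * q) :> R.
  apply: (@le_trans _ _ ((2 `^ (j.+1%:R * p) ^+ r.+1) `^ r%:R^-1)).
    by apply: le_powR; rewrite ?invr_ge0 ?exprn_ge0 // lerXn2r ?nnegrE ?powR_ge0.
  rewrite powR_expn ?powR_ge0 // -powRrM le_eqVlt; apply/orP; left; apply/eqP; congr (_ `^ _).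
  by rewrite qE -pr; ring.
apply: le_trans (_ : 2 `^ (- j%:R) `^ q * (2 `^ q * (W `^ r%:R^-1 * 2 `^ (j.+1%:R * q))) <= _).
  by rewrite !ler_wpM2l ?powR_ge0.
have -> : 4 = 2 `^ 2 :> R by rewrite powR_mulrn // expr2 -natrM.
rewrite -!powRrM le_eqVlt; apply/orP; left; apply/eqP.
rewrite mulrCA !mulrA -!pow2D mulrAC -pow2D mulrC [RHS]mulrC; congr (_ * 2 `^ _).
by rewrite -natr1; ring.
Qed.

(* [J] levels suffice: [|Y| ^ (q + 1) * 2 ^ (- J * (q - p)) <= 1]. *)
Let J := (2 * r.+1 * l)%N.

Lemma small_part_le (f : V -> R) (F : seq V) : uniq F ->
    (forall x, 0 <= f x) -> (forall x, f x <= 2 `^ (- J%:R)) ->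
    (forall U, uniq U -> \sum_(x <- U) f x `^ p <= 1) ->
  \sum_(x <- F) (\sum_(n <- Y) f (x + g n)) `^ q <= 1.
Proof.
move=> uF f0 fJ f1.
have pq : p <= q.
  by rewrite pE qE ler_wpM2l // lef_pV2 ?posrE ?ltr0n // ler_nat.
have fq x : f x `^ q <= 2 `^ (- J%:R * (q - p)) * f x `^ p.
  have -> : f x `^ q = f x `^ (q - p) * f x `^ p.
    by rewrite -powRD subrK // gt_eqF.
  rewrite ler_wpM2r ?powR_ge0 // powRrM; apply: le_powR; rewrite ?subr_ge0 ?powR_ge0 //.
have M2 : (size Y)%:R <= 2 `^ l%:R :> R.
  rewrite powR_mulrn // -natrX ler_nat ltnW // /l; exact: trunc_log_ltn.
apply: (@le_trans _ _ (\sum_(x <- F) (size Y)%:R `^ q *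
    \sum_(n <- Y) 2 `^ (- J%:R * (q - p)) * f (x + g n) `^ p)).
  apply: ler_sum => x _; apply: le_trans (sum_powR_le _ q_gt0 _) _ => //.
  by rewrite ler_wpM2l ?powR_ge0 //; apply: ler_sum.
rewrite -mulr_sumr exchange_big /=.
apply: (@le_trans _ _ ((size Y)%:R `^ q * \sum_(n <- Y) 2 `^ (- J%:R * (q - p)))).
  rewrite ler_wpM2l ?powR_ge0 //; apply: ler_sum => n _.
  rewrite -mulr_sumr ler_piMr ?powR_ge0 //.
  have := f1 [seq x + g n | x <- F]; rewrite big_map; apply.
  by rewrite map_inj_uniq //; apply: addIr.
rewrite sumr_const_seq.
apply: (@le_trans _ _ (2 `^ (l%:R * q) * (2 `^ l%:R * 2 `^ (- J%:R * (q - p))))).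
  rewrite ler_pM ?mulr_ge0 ?powR_ge0 //.
    by rewrite powRrM; apply: le_powR; rewrite ?(ltW q_gt0).
  by rewrite ler_wpM2r ?powR_ge0.
rewrite -!pow2D -[leRHS](powRr0 2) ler_powR ?ler1n //.
have -> : l%:R * q + (l%:R + - J%:R * (q - p)) = - (l%:R * (r.+1%:R / r%:R)).
  rewrite /J natrM natrM pE qE natrD natrM -natr1.
  by field; rewrite !gt_eqF //= -[1 + _]natr1 ltr0n.
by rewrite oppr_le0 mulr_ge0 ?divr_ge0.
Qed.

(** As [f <= 1], it splits into [J] dyadic levels, each dominated by a multiple of an indicator, and
    a part below [2 ^ (- J)]. Recombining the [J.+1] pieces loses only powers of [J], which is
    logarithmic in [|Y|]. *)
Lemma strong_type (f : V -> R) (F : seq V) : uniq F -> (forall x, 0 <= f x) ->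
    (forall U, uniq U -> \sum_(x <- U) f x `^ p <= 1) ->
  \sum_(x <- F) (\sum_(n <- Y) f (x + g n)) `^ q <=
    (4 * J.+1%:R ^+ 2 * W `^ (2 * r + 1)%:R^-1) `^ q.
Proof.
move=> uF f0 f1.
have fle1 x : f x <= 1.
  have := f1 [:: x] isT; rewrite big_seq1 => fx; rewrite leNgt; apply/negP.
  move=> /(gt0_ltr_powR p_gt0); rewrite !nnegrE f0 ler01 powR1 ltNge fx.
  by move=> /(_ isT isT).
(* Only points reached from [F] matter, so the level sets are finite lists. *)
pose U := undup [seq x + g n | x <- F, n <- Y].
pose E j := [seq y <- U | 2 `^ (- j.+1%:R) < f y <= 2 `^ (- j%:R)].
pose fs y := if f y <= 2 `^ (- J%:R) then f y else 0.
have uE j : uniq (E j) by rewrite filter_uniq ?undup_uniq.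
have lev y : y \in U -> f y <= \sum_(j < J) 2 `^ (- j%:R) * (y \in E j)%:R + fs y.
  move=> yU; rewrite /fs; case: (leP (f y) (2 `^ (- J%:R))) => fJ.
    by rewrite lerDr sumr_ge0 // => j _; rewrite mulr_ge0 ?powR_ge0.
  have [j jJ yE] : exists2 j, (j < J)%N & y \in E j.
    move: fJ; elim: J => [|j IH]; first by rewrite oppr0 powRr0 ltNge fle1.
    move=> fj; have [fj'|/IH[i ij yi]] := leP (f y) (2 `^ (- j%:R)).
      by exists j => //; rewrite mem_filter fj fj'.
    by exists i => //; apply: ltnW.
  rewrite addr0 (bigD1 (Ordinal jJ)) //= yE mulr1.
  move: yE; rewrite mem_filter => /andP[/andP[_ fj] _].
  by apply: le_trans fj _; rewrite lerDl sumr_ge0 // => i _; rewrite mulr_ge0 ?powR_ge0.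
pose b x := \sum_(n <- Y) fs (x + g n).
pose a (j : 'I_J.+1) x := if (j < J)%N then 2 `^ (- j%:R) * (hits (E j) x)%:R else b x.
have fs0 x : 0 <= fs x by rewrite /fs; case: ifP.
have a0 x j : 0 <= a j x.
  by rewrite /a; case: ifP => _; rewrite ?mulr_ge0 ?powR_ge0 ?sumr_ge0.
have fa x : x \in F -> \sum_(n <- Y) f (x + g n) <= \sum_(j < J.+1) a j x.
  move=> xF; apply: (@le_trans _ _ (\sum_(n <- Y)
      (\sum_(j < J) 2 `^ (- j%:R) * (x + g n \in E j)%:R + fs (x + g n)))).
    rewrite big_seq [leRHS]big_seq; apply: ler_sum => n nY; apply: lev.
    by rewrite mem_undup; apply/allpairsP; exists (x, n).
  rewrite big_split /= big_ord_recr /= {2}/a ltnn lerD2r exchange_big /=.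
  apply: ler_sum => j _; rewrite /a /= ltn_ord -mulr_sumr -natr_sum.
  by rewrite /hits -sum1_count [in leRHS]big_mkcond /= ler_wpM2l ?powR_ge0.
have asum (j : 'I_J) : \sum_(x <- F) a (widen_ord (leqnSn J) j) x `^ q <= l%:R * (4 `^ q * W `^ r%:R^-1).
  rewrite /a /= ltn_ord; apply: level_piece_le => //.
  apply: (level_size_le f0); first exact: f1.
  by move=> x; rewrite mem_filter => /andP[/andP[/ltW]].
have bsum : \sum_(x <- F) b x `^ q <= 1.
  apply: small_part_le => // [x|U' uU'].
    by rewrite /fs; case: ifP => // _; apply: powR_ge0.
  apply: le_trans (f1 U' uU'); apply: ler_sum => x _.
  by apply: le_powR; rewrite ?(ltW p_gt0) // /fs; case: ifP.
apply: (@le_trans _ _ (\sum_(x <- F) (J.+1%:R `^ q * \sum_(j < J.+1) a j x `^ q))).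
  rewrite big_seq [leRHS]big_seq; apply: ler_sum => x xF.
  apply: (@le_trans _ _ ((\sum_(j < J.+1) a j x) `^ q)).
    by apply: le_powR; rewrite ?(ltW q_gt0) ?sumr_ge0 ?fa.
  apply: le_trans (sum_powR_le _ q_gt0 _) _ => //.
  by rewrite /index_enum -enumT size_enum_ord.
rewrite -mulr_sumr exchange_big big_ord_recr /=.
rewrite [X in _ * (_ + X)](_ : _ = \sum_(x <- F) b x `^ q); last first.
  by apply: eq_bigr => x _; rewrite /a ltnn.
set Z := 4 `^ q * W `^ r%:R^-1 in asum.
have Z1 : 1 <= Z.
  have ge1 x t : 1 <= x -> 0 <= t -> 1 <= x `^ t :> R.
    by move=> x1 ht; rewrite -[leLHS](powRr0 x) ler_powR.
  by rewrite -[leLHS]mulr1 ler_pM // ge1 ?invr_ge0 ?(ltW q_gt0) // ler1n.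
have JZ : \sum_(j < J) \sum_(x <- F) a (widen_ord (leqnSn J) j) x `^ q + \sum_(x <- F) b x `^ q
    <= J.+1%:R ^+ 2 * Z.
  apply: (@le_trans _ _ (J%:R * (l%:R * Z) + Z)).
    apply: lerD; last exact: le_trans bsum Z1.
    apply: le_trans (ler_sum _ (fun j _ => asum j)) _.
    by rewrite sumr_const card_ord -[leLHS]mulr_natl.
  have lJ : (l <= J)%N by rewrite /J leq_pmull // muln_gt0.
  rewrite mulrA -[X in _ + X <= _]mul1r -mulrDl ler_wpM2r ?(le_trans ler01) //.
  by rewrite -natrM -natrX -[1]/(1%:R) -natrD ler_nat; nia.
apply: le_trans (ler_wpM2l (powR_ge0 _ _) JZ) _.
rewrite [leRHS]powRM ?mulr_ge0 ?exprn_ge0 ?powR_ge0 // (@powRM _ 4) ?exprn_ge0 // powR_expn // -powRrM.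
have -> : (2 * r + 1)%:R^-1 * q = r%:R^-1 by rewrite qE mulrA mulVf ?mul1r // pnatr_eq0 addn1.
rewrite /Z [leLHS](_ : _ = 4 `^ q * (J.+1%:R `^ q * J.+1%:R ^+ 2) * W `^ r%:R^-1); last by ring.
rewrite ler_wpM2r ?powR_ge0 // ler_wpM2l ?powR_ge0 //.
rewrite -powR_mulrn // -powRD; last by rewrite pnatr_eq0 implybT.
rewrite ler_powR ?ler1n //.
(* Hence [J.+1 ^ (q + 2) <= J.+1 ^ (2 q)]. *)
have : 2 <= q by rewrite qE ler_pdivlMr // -natrM ler_nat leq_addr.
by lra.
Qed.

End StrongType.

(** * Operator norms *)

(** Product of the three trivial bounds. For [r = 1] and [gamma] linear, the resulting exponent
    [2/3 - 1] equals [- D (1/p - 1/q)] with [D = 1]. *)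
Lemma sum_edges_le_cube (V : zmodType) (g : nat -> V) (Y : seq nat) (A B : seq V) :
    {in Y &, injective g} -> uniq Y -> uniq A -> uniq B ->
  (sum_edges g Y A B ^ 3 <= size Y ^ 2 * (size A * size B) ^ 2)%N.
Proof.
move=> ginj uY uA uB.
have le C D c : (forall x, x \in C -> sum_degree g Y D x <= c)%N ->
    (sum_edges g Y C D <= c * size C)%N.
  move=> H; rewrite /sum_edges -[size C]count_predT -iter_addn_0 -big_const_seq.
  by rewrite big_seq [leqRHS]big_seq; apply: leq_sum.
have IA : (sum_edges g Y A B <= size Y * size A)%N by apply: le => x _; apply: count_size.
have IB : (sum_edges g Y A B <= size Y * size B)%N.
  by rewrite sum_edgesC //; apply: le => x _; apply: count_size.
have IAB : (sum_edges g Y A B <= size B * size A)%N.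
  apply: le => x _; rewrite /sum_degree -size_filter -(size_map (fun n => - (x + g n))).
  apply: uniq_leq_size => [|_ /mapP[n + ->]]; last by rewrite mem_filter => /andP[].
  rewrite map_inj_in_uniq ?filter_uniq // => m n.
  rewrite !mem_filter => /andP[_ mY] /andP[_ nY] /oppr_inj/addrI.
  exact: ginj.
have -> : (size Y ^ 2 * (size A * size B) ^ 2 =
    size Y * size A * (size Y * size B) * (size B * size A))%N by ring.
by rewrite !expnS expn0 muln1 mulnA !leq_mul.
Qed.

Section RealBounds.
Variable R : realType.

Lemma root_le (k : nat) (a x b : R) : (0 < k)%N -> 0 <= a -> 0 <= x -> 0 <= b ->
  x ^+ k <= a * b ^+ k -> x <= a `^ k%:R^-1 * b.
Proof.
move=> k0 a0 x0 b0 H.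
rewrite -(@ler_pXn2r _ k) ?nnegrE ?mulr_ge0 ?powR_ge0 // exprMn.
by rewrite -[(a `^ _) ^+ k]powR_mulrn ?powR_ge0 // -powRrM mulVf ?pnatr_eq0 -?lt0n // powRr1.
Qed.

Lemma powR_ge1 (x a : R) : 1 <= x -> 0 <= a -> 1 <= x `^ a.
Proof. by move=> x1 a0; rewrite -[leLHS](powRr0 x) ler_powR. Qed.

Lemma curve_sum_edges_real (r : nat) (gamma : 'I_r -> {poly int}) (j0 : 'I_r) (eps : R) :
    0 < eps -> (forall i, (1 < size (gamma i))%N) ->
    (forall i j : 'I_r, (i < j)%N -> (size (gamma i) < size (gamma j))%N) ->
    (2 < size (gamma j0))%N ->
  exists2 C : R, 1 <= C & forall (N : nat) (Y : seq nat) (A B : seq 'rV[int]_r),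
    (0 < N)%N -> uniq Y -> {in Y, forall n, n <= N}%N -> uniq A -> uniq B ->
    (sum_edges (curve gamma) Y A B)%:R ^+ (2 * r + 1) <=
      C * N%:R `^ eps * (size Y)%:R ^+ r * (size A * size B)%:R ^+ r.+1.
Proof.
move=> eps0 deg0 deglt top.
pose k := (Num.truncn eps^-1).+1.
have k0 : (0 < k)%N by [].
have keps : k%:R^-1 <= eps.
  by rewrite invf_ple ?posrE ?ltr0n // ltW // truncnS_gt.
have [C C0 HC] := curve_sum_edges_le deg0 deglt top k0.
exists C%:R => [|N Y A B N0 uY YN uA uB]; first by rewrite ler1n.
have H := HC N Y A B N0 uY YN uA uB.
have := @root_le k (C * N)%:R ((sum_edges (curve gamma) Y A B)%:R ^+ (2 * r + 1))
  ((size Y)%:R ^+ r * (size A * size B)%:R ^+ r.+1) k0 (ler0n _ _).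
rewrite !mulr_ge0 ?exprn_ge0 // => /(_ isT isT) -/(_ _)/le_trans; apply.
  by rewrite -exprM -!natrX -natrM -natrX -natrM ler_nat.
rewrite mulrA !ler_wpM2r ?exprn_ge0 // natrM powRM // ler_pM ?powR_ge0 //.
  by rewrite ler1_powR ?ler1n // invf_le1 ?ltr0n // ler1n.
by rewrite ler_powR ?ler1n.
Qed.

(** With [t] the logarithm, [t delta ln 2 <= exp (t delta ln 2) = (2 ^ t) ^ delta <= N ^ delta]. *)
Lemma trunc_log_le (delta : R) : 0 < delta ->
  exists2 C : R, 0 <= C & forall M N : nat, (0 < M <= N)%N ->
    (trunc_log 2 M)%:R <= C * N%:R `^ delta.
Proof.
move=> d0; have ln2 : 0 < ln (2 : R) by rewrite ln_gt0 // ltr1n.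
exists (delta * ln 2)^-1 => [|M N /andP[M0 MN]]; first by rewrite invr_ge0 mulr_ge0 ?ltW.
rewrite mulrC ler_pdivlMr ?mulr_gt0 //; set t := trunc_log 2 M.
have tN : (2 : R) `^ t%:R <= N%:R.
  rewrite powR_mulrn // -natrX ler_nat; apply: leq_trans MN; exact: trunc_logP.
apply: le_trans (le_powR (ltW d0) (powR_ge0 _ _) tN).
rewrite -powRrM /powR pnatr_eq0 /=; apply: le_trans (expR_ge1Dx _).
by rewrite mulrA lerDr.
Qed.

End RealBounds.

(** * Norms through finite sums *)

Section Norms.
Variables (R : realType) (T : choiceType).
Implicit Types f : T -> R[i].

Local Notation normc := ComplexField.Normc.normc.

Lemma normc_ge0 (z : R[i]) : 0 <= normc z.
Proof. by case: z => a b; apply: sqrtr_ge0. Qed.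

Lemma normc_nat n : normc (n%:R : R[i]) = n%:R.
Proof.
apply: etrans (@normcMn R (1 : R[i]) n) _.
by rewrite ComplexField.Normc.normc1.
Qed.

Lemma normc_sum (I : Type) (s : seq I) (F : I -> R[i]) :
  normc (\sum_(i <- s) F i) <= \sum_(i <- s) normc (F i).
Proof.
elim: s => [|i s IH]; first by rewrite !big_nil ComplexField.Normc.normc0.
rewrite !big_cons; apply: le_trans (@le_normcD R _ _) _.
by rewrite lerD2l.
Qed.

Lemma lnorm_le1 p f U : 0 < p -> (lnorm p f <= 1)%E -> uniq U ->
  \sum_(x <- U) normc (f x) `^ p <= 1.
Proof.
move=> p0; rewrite /lnorm; set S := esum _ _ => S1 uU.
have S0 : (0 <= S)%E by apply: esum_ge0 => x _; rewrite lee_fin powR_ge0.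
have {}S1 : (S <= 1)%E.
  have := gt0_ler_poweR (ltW p0) _ _ S1.
  rewrite -poweRrM mulVf ?gt_eqF // poweRe1 // poweR1r; apply.
    by rewrite in_itv /= poweR_ge0 leey.
  by rewrite in_itv /= lee_fin ler01 leey.
rewrite -lee_fin; apply: le_trans S1; apply: esum_ge; exists [set` U].
  by split=> //; apply: finite_seq.
by rewrite -fsbig_seq // sumEFin.
Qed.

Lemma lnorm_le q f b : 0 < q -> 0 <= b ->
    (forall F, uniq F -> \sum_(x <- F) normc (f x) `^ q <= b `^ q) ->
  (lnorm q f <= b%:E)%E.
Proof.
move=> q0 b0 H; rewrite /lnorm; set S := esum _ _.
have S0 : (0 <= S)%E by apply: esum_ge0 => x _; rewrite lee_fin powR_ge0.
have Sb : (S <= (b `^ q)%:E)%E.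
  apply: ge_ereal_sup => _ [X [finX _] <-].
  by rewrite fsbig_finite // sumEFin lee_fin; apply: H; apply: fset_uniq.
have -> : b%:E = ((b `^ q)%:E `^ q^-1)%E.
  by rewrite poweR_EFin -powRrM divff ?gt_eqF // powRr1.
apply: gt0_ler_poweR => //; first by rewrite invr_ge0 ltW.
  by rewrite in_itv /= S0 leey.
by rewrite in_itv /= lee_fin powR_ge0 leey.
Qed.

End Norms.

Lemma opnorm_average_le (R : realType) (r : nat) (gamma : 'I_r -> {poly int})
    (p q W : R) (Y : {fset nat}) :
    (0 < r)%N -> p * r.+1%:R = (2 * r + 1)%:R -> q * r%:R = (2 * r + 1)%:R ->
    1 <= W ->
    (forall A B : seq 'rV[int]_r, uniq A -> uniq B ->
      (sum_edges (curve gamma) Y A B)%:R ^+ (2 * r + 1) <=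
        W * (size A * size B)%:R ^+ r.+1) ->
  (opnorm p q (@average R r gamma Y) <=
    ((#|` Y|%:R)^-1 * (4 * (2 * r.+1 * (trunc_log 2 #|` Y|).+1).+1%:R ^+ 2
       * W `^ (2 * r + 1)%:R^-1))%:E)%E.
Proof.
move=> r0 pr qr W1 HW.
have p0 : 0 < p by rewrite -(@pmulr_lgt0 _ r.+1%:R) ?ltr0n // pr ltr0n addn1.
have q0 : 0 < q by rewrite -(@pmulr_lgt0 _ r%:R) ?ltr0n // qr ltr0n addn1.
apply: ge_ereal_sup => _ [f /= f1 <-].
apply: lnorm_le => // [|F uF]; first by rewrite !mulr_ge0 ?invr_ge0 ?exprn_ge0 ?powR_ge0.
pose h x := ComplexField.Normc.normc (f x).
have h0 x : 0 <= h x by apply: normc_ge0.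
have := strong_type r0 pr qr W1 (fset_uniq Y) HW uF h0 (fun U => lnorm_le1 p0 f1).
set J := (2 * r.+1 * _)%N; move=> HF.
rewrite powRM ?invr_ge0 ?mulr_ge0 ?exprn_ge0 ?powR_ge0 //.
apply: le_trans (ler_wpM2l (powR_ge0 _ _) HF).
rewrite mulr_sumr; apply: ler_sum => x _.
rewrite -powRM ?invr_ge0 ?sumr_ge0 //; apply: le_powR; rewrite ?(ltW q0) ?normc_ge0 //.
rewrite /average ComplexField.Normc.normcM ComplexField.Normc.normcV normc_nat.
by rewrite ler_wpM2l ?invr_ge0 // normc_sum.
Qed.

(** The exponent [e] will be [r] in general and 2 in the linear case. Half of [eps] pays for the
    incidence bound and a quarter for each of the two logarithmic factors. *)
Lemma opnorm_average_eps (R : realType) (r e : nat) (gamma : 'I_r -> {poly int})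
    (p q eps C1 : R) :
    (0 < r)%N -> p * r.+1%:R = (2 * r + 1)%:R -> q * r%:R = (2 * r + 1)%:R ->
    0 < eps -> 1 <= C1 ->
    (forall (N : nat) (Y : seq nat) (A B : seq 'rV[int]_r),
      (0 < N)%N -> uniq Y -> {in Y, forall n, n <= N}%N -> uniq A -> uniq B ->
      (sum_edges (curve gamma) Y A B)%:R ^+ (2 * r + 1) <=
        C1 * N%:R `^ (eps / 2) * (size Y)%:R ^+ e * (size A * size B)%:R ^+ r.+1) ->
  exists2 C : R, 0 < C & forall (N : nat) (Y : {fset nat}),
    (0 < #|` Y| <= N)%N -> {in Y, forall n, n <= N}%N ->
    (opnorm p q (@average R r gamma Y) <=
      (C * N%:R `^ eps * #|` Y|%:R `^ (e%:R / (2 * r + 1)%:R - 1))%:E)%E.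
Proof.
move=> r0 pr qr eps0 C11 HC1.
have eps4 : 0 < eps / 4 by rewrite divr_gt0.
have [C0 C00 HC0] := trunc_log_le eps4.
pose c : R := (2 * r.+1).+1%:R * (C0 + 1).
have c0 : 0 < c by rewrite mulr_gt0 ?ltr0n // ltr_wpDl.
exists (4 * c ^+ 2 * C1) => [|N Y /andP[M0 MN] YN].
  by rewrite mulr_gt0 ?(lt_le_trans ltr01 C11) // mulr_gt0 ?exprn_gt0.
have N0 : (0 < N)%N by apply: leq_trans MN.
set M := #|` Y| in M0 MN *; set t := trunc_log 2 M.
have M1 : 1 <= M%:R :> R by rewrite ler1n.
have N1 : 1 <= N%:R :> R by rewrite ler1n.
set s : R := (2 * r + 1)%:R^-1.
have s0 : 0 <= s by rewrite invr_ge0.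
have s1 : s <= 1 by rewrite invf_le1 ?ler1n ?ltr0n addn1.
set W : R := C1 * N%:R `^ (eps / 2) * M%:R ^+ e.
have e20 : 0 <= eps / 2 by rewrite divr_ge0 ?ltW.
have W1 : 1 <= W.
  by rewrite /W -[leLHS]mulr1 ler_pM ?exprn_ege1 // -[leLHS]mulr1 ler_pM // powR_ge1.
have := opnorm_average_le r0 pr qr W1 (fun A B => HC1 N Y A B N0 (fset_uniq Y) YN).
move=> /le_trans; apply; rewrite lee_fin -/M -/t -/s.
have tN : t.+1%:R <= (C0 + 1) * N%:R `^ (eps / 4).
  rewrite -natr1 mulrDl mul1r lerD ?powR_ge1 ?divr_ge0 ?(ltW eps0) //.
  by apply: HC0; rewrite M0.
have JN : (2 * r.+1 * t.+1).+1%:R <= c * N%:R `^ (eps / 4).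
  rewrite /c -mulrA; apply: le_trans (ler_wpM2l _ tN) => //.
  by rewrite -natrM ler_nat (mulSn (2 * r.+1)%N) -(add1n (2 * r.+1 * t.+1)%N) leq_add2r.
have JN2 : (2 * r.+1 * t.+1).+1%:R ^+ 2 <= c ^+ 2 * N%:R `^ (eps / 2).
  have -> : eps / 2 = eps / 4 * 2%:R by field.
  rewrite powRrM powR_mulrn ?powR_ge0 // -exprMn lerXn2r ?nnegrE //.
  by rewrite mulr_ge0 ?powR_ge0 // ltW.
have Ws : W `^ s <= C1 * N%:R `^ (eps / 2) * M%:R `^ (e%:R * s).
  rewrite /W !powRM ?mulr_ge0 ?powR_ge0 ?exprn_ge0 ?(le_trans ler01) //.
  rewrite powR_expn //; apply: ler_wpM2r; rewrite ?powR_ge0 //.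
  apply: ler_pM; rewrite ?powR_ge0 ?ler1_powR //.
  by rewrite powR_ge1.
have -> : M%:R `^ (e%:R * s - 1) = M%:R^-1 * M%:R `^ (e%:R * s) :> R.
  rewrite powRD ?powR_inv1 // 1?mulrC //.
  by rewrite pnatr_eq0 -lt0n M0 implybT.
have -> : eps = eps / 2 + eps / 2 by field.
rewrite powRD; last by rewrite pnatr_eq0 -lt0n N0 implybT.
rewrite [leRHS](_ : _ = M%:R^-1 * (4 * (c ^+ 2 * N%:R `^ (eps / 2)) *
  (C1 * N%:R `^ (eps / 2) * M%:R `^ (e%:R * s)))); last by ring.
rewrite ler_wpM2l ?invr_ge0 // ler_pM ?mulr_ge0 ?exprn_ge0 ?powR_ge0 //.
by rewrite ler_wpM2l.
Qed.

Lemma mem_truncation (X : set nat) (N n : nat) :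
  (n \in truncation X N) = (1 <= n <= N)%N && (n \in X).
Proof. by rewrite !inE /= mem_iota add1n ltnS. Qed.

Lemma card_truncation_le (X : set nat) (N : nat) : (#|` truncation X N| <= N)%N.
Proof.
rewrite -[leqRHS](size_iota 1 N); apply: uniq_leq_size; first exact: fset_uniq.
by move=> n; rewrite mem_truncation mem_iota add1n ltnS => /andP[].
Qed.

Theorem theorem1p6 (R : realType) (r : nat) (hr : (1 <= r)%N)
    (gamma : 'I_r -> {poly int}) (hgamma : separated_system gamma)
    (p q : R) (hp : p = 2 - 1 / (r.+1)%:R) (hpq : 1 / p + 1 / q = 1)
    (eps : R) (heps : 0 < eps) :
  exists C : R, 0 < C /\
    forall X : set nat, X `<=` [set n | (1 <= n)%N] -> infinite_set X ->
      \forall N \near \oo,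
        (opnorm p q (@average R r gamma (truncation X N)) <=
         (C * N%:R `^ eps *
          (#|` truncation X N|%:R
             `^ (- ((total_degree gamma)%:R * (1 / p - 1 / q)))
           + #|` truncation X N|%:R `^ (1 / q - 1)
           + #|` truncation X N|%:R `^ (- (1 / p))))%:E)%E.
Proof.
have r1 : r.+1%:R != 0 :> R by rewrite pnatr_eq0.
have r0 : r%:R != 0 :> R by rewrite pnatr_eq0 -lt0n.
have r2 : (2 * r + 1)%:R != 0 :> R by rewrite pnatr_eq0 addn1.
have pr : p * r.+1%:R = (2 * r + 1)%:R.
  by rewrite hp mulrBl div1r mulVf // -natr1 natrD natrM; ring.
have pV : 1 / p = r.+1%:R / (2 * r + 1)%:R.
  by rewrite -pr invfM mulrCA divff // mulr1 mul1r.
have qV : 1 / q = r%:R / (2 * r + 1)%:R.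
  have -> : 1 / q = 1 - 1 / p by move: hpq => /(canRL (addKr _)) ->; rewrite addrC.
  apply: (mulIf r2); rewrite pV mulrBl mul1r !divfK // -natr1 natrD natrM; ring.
have qr : q * r%:R = (2 * r + 1)%:R.
  have q0 : q != 0.
    apply: contra_neq r0 => q0; move/eqP: qV.
    by rewrite q0 invr0 mulr0 eq_sym mulf_eq0 invr_eq0 (negPf r2) orbF => /eqP.
  by have := congr1 (fun x => q * x * (2 * r + 1)%:R) qV; rewrite mulrA mulr1 divff // mul1r mulrA divfK.
have [deg1 deglt] := hgamma; rewrite /degree in deg1 deglt.
have deg0 i : (1 < size (gamma i))%N by rewrite -subn_gt0 subn1 deg1.
have deglt' (i j : 'I_r) : (i < j)%N -> (size (gamma i) < size (gamma j))%N.
  by move=> /deglt; rewrite -ltnS !prednK // ltnW.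
(* In both cases a single power of [|Y|] remains to be compared with the three terms. *)
have finish (e : nat) : (exists2 C : R, 0 < C & forall (N : nat) (Y : {fset nat}),
    (0 < #|` Y| <= N)%N -> {in Y, forall n, n <= N}%N ->
    (opnorm p q (@average R r gamma Y) <=
      (C * N%:R `^ eps * #|` Y|%:R `^ (e%:R / (2 * r + 1)%:R - 1))%:E)%E) ->
    (forall x : R, x `^ (e%:R / (2 * r + 1)%:R - 1) <=
      x `^ (- ((total_degree gamma)%:R * (1 / p - 1 / q))) + x `^ (1 / q - 1) + x `^ (- (1 / p))) ->
    exists C : R, 0 < C /\
    forall X : set nat, X `<=` [set n | (1 <= n)%N] -> infinite_set X ->
      \forall N \near \oo,
        (opnorm p q (@average R r gamma (truncation X N)) <=
         (C * N%:R `^ eps *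
          (#|` truncation X N|%:R
             `^ (- ((total_degree gamma)%:R * (1 / p - 1 / q)))
           + #|` truncation X N|%:R `^ (1 / q - 1)
           + #|` truncation X N|%:R `^ (- (1 / p))))%:E)%E.
  move=> [C C0 HC] He; exists C; split=> // X X1 Xinf.
  (* Any [N] beyond one element of [X] is large enough: the truncation is then nonempty. *)
  have [n0 Xn0] := infinite_setN0 Xinf.
  exists n0 => // N /= n0N.
  apply: le_trans (HC N _ _ _) _.
  - rewrite card_truncation_le andbT cardfs_gt0; apply/fset0Pn; exists n0.
    by rewrite mem_truncation n0N andbT X1 //= inE.
  - by move=> n; rewrite mem_truncation => /andP[/andP[]].
  - by rewrite lee_fin ler_wpM2l // mulr_ge0 ?powR_ge0 // ltW.
have eps2 : 0 < eps / 2 by rewrite divr_gt0.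
have [/existsP[j0 top]|notop] := boolP [exists j, (2 < size (gamma j))%N].
  have [C1 C11 HC1] := curve_sum_edges_real eps2 deg0 deglt' top.
  apply: (finish r); first exact: opnorm_average_eps HC1.
  (* Here [r / (2r + 1) - 1 = 1/q - 1 = - 1/p], the exponent of the last term. *)
  move=> x; rewrite [r%:R / _ - 1](_ : _ = - (1 / p)) ?lerDr ?addr_ge0 ?powR_ge0 //.
  by move: hpq => /(canRL (addKr _)); rewrite qV => ->; rewrite addrK.
have sz2 j : size (gamma j) = 2.
  by apply/eqP; rewrite eqn_leq deg0 andbT leqNgt; move/existsPn: notop; apply.
(* All degrees equal 1, while they increase strictly with the index. *)
have rE : r = 1%N.
  apply/eqP; rewrite eqn_leq hr andbT leqNgt; apply/negP => r2'.
  by have := @deglt' (Ordinal (ltnW r2')) (Ordinal r2') (ltnSn _); rewrite !sz2.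
have inj : injective (curve gamma).
  move=> m n; pose j : 'I_r := Ordinal hr.
  move=> /rowP/(_ j); rewrite !mxE.
  have lc : (gamma j)`_1 != 0
    by have := lead_coef_eq0 (gamma j); rewrite lead_coefE sz2 => ->; rewrite -size_poly_gt0 sz2.
  rewrite !horner_coef sz2 !big_ord_recr !big_ord0 /= !add0r !expr0 !expr1 => eq_mn.
  by have [] := mulfI lc (addrI _ eq_mn).
apply: (finish 2%N).
  apply: (@opnorm_average_eps _ _ _ _ _ _ _ 1) => // N Y A B N0 uY YN uA uB.
  have -> : (2 * r + 1 = 3)%N by rewrite rE.
  have -> : r.+1 = 2%N by rewrite rE.
  rewrite mul1r -mulrA; apply: le_trans (_ : _ <= 1 * _) _; last first.
    apply: ler_wpM2r; last by apply: powR_ge1; rewrite ?ler1n ?(ltW eps2).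
    by rewrite mulr_ge0 ?exprn_ge0.
  rewrite mul1r -!natrX -natrM ler_nat; apply: sum_edges_le_cube => //.
  by move=> m n _ _; apply: inj.
move=> x; rewrite -[leLHS]addr0 -addrA lerD ?addr_ge0 ?powR_ge0 //.
rewrite le_eqVlt; apply/orP; left; apply/eqP; congr (_ `^ _).
have -> : total_degree gamma = 1%N.
  by rewrite /total_degree; under eq_bigr do rewrite /degree sz2; rewrite sum1_card card_ord rE.
by rewrite pV qV rE; field.
Qed.
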